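(* Let $F\in\mathcal{F}_n$. The map $\delta_{321}$ sending a $321$-avoiding full rook placement $R$ on $F$ to $(D_{R,F},D_F)$, where $D_{R,F}$ is the Dyck path with height sequence $j_i=2\ell_i-h_i$ ($0\le i\le 2n$), is a bijection from the set $\mathcal{R}_F(321)$ of $321$-avoiding full rook placements on $F$ onto $\mathcal{D}^2_F$. Consequently there is a bijection $\mathcal{M}_F(321)\to\mathcal{D}^2_F$.
   Context: A Dyck path of semilength $n$ is a lattice path from $(0,n)$ to $(n,0)$ with unit east and south steps never going strictly below $y=n-x$; $\mathcal{D}_n$ is their set. $\mathcal{F}_n$ is the set of Ferrers boards (sets of unit squares bounded by the coordinate axes and a path) whose border $D_F$ is such a Dyck path; border vertices $V_0=(0,n),\dots,V_{2n}=(n,0)$ in order. The height sequence of a Dyck path is $d_0=0$, $d_{i+1}=d_i+1$ if step $i+1$ is east and $d_i-1$ if south; $h_0\dots h_{2n}$ denotes that of $D_F$. $\mathcal{D}^2_F$ is the set of pairs $(D_0,D_F)$, $D_0\in\mathcal{D}_n$, with $D_0$ never strictly above $D_F$. A full rook placement $R$ on $F$ has exactly one square in each row and column of $F$; $\Gamma(V)$ for $V=(a,b)$ is the set of unit squares in $[0,a]\times[0,b]$; a set of squares with at most one per row and column determines a permutation by standardizing. $R$ avoids $\tau$ if for every border vertex $V$ the permutation determined by $R\cap\Gamma(V)$ avoids $\tau$. $\ell_i$ is the length of the longest increasing subsequence of the permutation determined by $R\cap\Gamma(V_i)$ (it is known that $j_i$ so defined is the height sequence of a Dyck path weakly below $D_F$).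 Matchings: $\mathcal{M}_F(\tau)$ is the set of perfect matchings $M$ of $[2n]$ whose shape is $F$ (border read from $1$ to $2n$: east step for each opener, south for each closer) that avoid $\tau\in S_k$, i.e. there are no $i_1<\dots<i_{2k}$ with all pairs $(i_a,i_{2k+1-\tau(a)})$ in $M$. *)

(* Defs.v *)
From mathcomp Require Import all_boot all_fingroup all_algebra.
Set Implicit Arguments.
Unset Strict Implicit.
Unset Printing Implicit Defensive.

(* A lattice path of length 2n starting at (0,n) is its word of steps:
   true is a unit east step, false a unit south step. *)
Definition lpath (n : nat) : Type := (n.*2).-tuple bool.

(* The truncated subtraction is exact on Dyck paths, which have exactly n
   south steps. *)
Definition vertex (n : nat) (p : lpath n) (i : nat) : nat * nat :=
  (count_mem true (take i p), n - count_mem false (take i p)).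

Definition is_dyck (n : nat) (p : lpath n) : bool :=
  (vertex p n.*2 == (n, 0)) &&
  [forall i : 'I_(n.*2).+1, n <= (vertex p i).1 + (vertex p i).2].

Definition dyck (n : nat) : Type := {p : lpath n | is_dyck p}.

Fixpoint height (n : nat) (p : lpath n) (i : nat) : int :=
  if i is i'.+1 then
    if nth false p i' then (height p i' + 1)%R else (height p i' - 1)%R
  else 0%R.

(* The vertical line through a lattice point V meets a path in a segment
   whose endpoints are vertices of the path. *)
Definition strictly_above (n : nat) (p : lpath n) (V : nat * nat) : bool :=
  [forall i : 'I_(n.*2).+1,
     ((vertex p i).1 == V.1) ==> ((vertex p i).2 < V.2)].

Definition never_above (n : nat) (p q : lpath n) : bool :=
  [forall i : 'I_(n.*2).+1, ~~ strictly_above q (vertex p i)].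

Definition dyck_pairs (n : nat) (DF : dyck n) : Type :=
  {P : dyck n * dyck n | (P.2 == DF) && never_above (sval P.1) (sval P.2)}.

(* The square (c, r) is [c, c+1] x [r, r+1]: columns are numbered from left to
   right and rows from bottom to top. *)
Definition square (n : nat) : Type := ('I_n * 'I_n)%type.

Definition Gamma (n : nat) (V : nat * nat) : {set square n} :=
  [set s : square n | (s.1 < V.1) && (s.2 < V.2)].

(* The region bounded by the axes and a path with east and south steps is the
   union of the rectangles [0, a] x [0, b] over the vertices (a, b). *)
Definition board (n : nat) (p : lpath n) : {set square n} :=
  \bigcup_(i < (n.*2).+1) Gamma n (vertex p i).

Definition full_rook_placement (n : nat) (F R : {set square n}) : bool :=
  [&& R \subset F,
      [forall c : 'I_n, #|[set s in R | s.1 == c]| == 1]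
    & [forall r : 'I_n, #|[set s in R | s.2 == r]| == 1]].

(* One-line notation, with values 1, ..., #|S|, of the permutation determined
   by a set S of squares with at most one square per row and column. *)
Definition standardize (n : nat) (S : {set square n}) : seq nat :=
  [seq #|[set t in S | (t.2 <= s.2)%N]|
     | s : square n <- sort (fun s t : square n => (s.1 <= t.1)%N) (enum S)].

Definition order_isomorphic (u : seq nat) (k : nat) (tau : 'S_k) : bool :=
  (size u == k) &&
  [forall a : 'I_k, forall b : 'I_k,
     (nth 0 u a < nth 0 u b) == (tau a < tau b)].

Definition contains (w : seq nat) (k : nat) (tau : 'S_k) : bool :=
  [exists m : (size w).-tuple bool, order_isomorphic (mask m w) tau].

Definition placement_avoids (n : nat) (DF : dyck n) (R : {set square n})
    (k : nat) (tau : 'S_k) : bool :=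
  [forall i : 'I_(n.*2).+1,
     ~~ contains (standardize (R :&: Gamma n (vertex (sval DF) i))) tau].

Definition avoiding_placements (n : nat) (F : {set square n}) (DF : dyck n)
    (k : nat) (tau : 'S_k) : Type :=
  {R : {set square n} | full_rook_placement F R && placement_avoids DF R tau}.

(* Length of the longest (strictly) increasing subsequence. *)
Definition lis (w : seq nat) : nat :=
  \max_(m : (size w).-tuple bool | sorted ltn (mask m w)) size (mask m w).

Definition ell (n : nat) (DF : dyck n) (R : {set square n}) (i : nat) : nat :=
  lis (standardize (R :&: Gamma n (vertex (sval DF) i))).

(* 'I_(n.*2) stands for [2n], with every label lowered by one. *)
Definition perfect_matching (n : nat) (M : {set {set 'I_(n.*2)}}) : bool :=
  partition M [set: 'I_(n.*2)] && [forall B in M, #|B| == 2].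

Definition opener (n : nat) (M : {set {set 'I_(n.*2)}}) (x : 'I_(n.*2)) : bool :=
  [exists y : 'I_(n.*2), (x < y) && ([set x; y] \in M)].

Definition matching_shape (n : nat) (M : {set {set 'I_(n.*2)}}) : lpath n :=
  [tuple opener M x | x < n.*2].

(* With all indices and values lowered by one, i_(2k+1-tau(a)) becomes the
   entry of index 2k-1-tau(a), i.e. rev_ord of tau(a) in 'I_(k + k). *)
Definition matching_contains (n : nat) (M : {set {set 'I_(n.*2)}})
    (k : nat) (tau : 'S_k) : bool :=
  [exists i : {ffun 'I_(k + k) -> 'I_(n.*2)},
     [forall a : 'I_(k + k), forall b : 'I_(k + k), (a < b) ==> (i a < i b)] &&
     [forall a : 'I_k,
        [set i (lshift k a); i (rev_ord (lshift k (tau a)))] \in M]].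

Definition avoiding_matchings (n : nat) (DF : dyck n)
    (k : nat) (tau : 'S_k) : Type :=
  {M : {set {set 'I_(n.*2)}} |
    [&& perfect_matching M, matching_shape M == sval DF & ~~ matching_contains M tau]}.

Definition perm321 : 'S_3 := perm (@rev_ord_inj 3).

(* Main.v *)
(* Number the steps of the border of F from 0 to 2n - 1 and turn a rook in
   column c and row r into an arc from the east step spanning c to the south
   step spanning r.  This identifies full rook placements on F with matchings of
   the steps; under it an increasing sequence of rooks in Gamma(V_i) is a nest of
   arcs over the point i, and the pattern 321 in some Gamma(V_i) is a 3-crossing.

   For i <= j let shape(i, j) record the number of arcs with opener < i and
   closer >= j, and the size of their largest nest; these are |lambda| and
   lambda_1 for the Robinson-Schensted shape lambda of the corresponding
   rectangle.  Without 3-crossings lambda has at most two rows, so nothing is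
   lost, and Fomin's local rules for growth diagrams determine shape(i, j + 1)
   and the presence of the arc (i, j) from shape(i + 1, j + 1), shape(i, j) and
   shape(i + 1, j).  Hence the diagonal shape(i, i) determines the matching, and
   running the backward rule from an arbitrary admissible diagonal constructs
   one.  An admissible diagonal is the same thing as a pair in D^2_F. *)
Require Import Defs.
From mathcomp Require Import all_boot all_fingroup all_algebra.
From mathcomp Require Import zify.
Set Implicit Arguments.
Unset Strict Implicit.
Unset Printing Implicit Defensive.

(** * Nests of arcs and their local growth rules *)

Section Arcs.
Variables (N : nat) (S : rel nat).

Definition row_hit i j := has (fun q => (j <= q) && S i q) (iota 0 N).
Definition col_hit i j := has (fun p => S p j) (iota 0 i).

(** Openers are counted rather than arcs; the two counts agree once every opener has at most one
    closer. *)
Fixpoint arc_count i j :=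
  if i is i'.+1 then arc_count i' j + row_hit i' j else 0.

(* The size of a largest nest among the arcs (p, q) with p < i and j <= q,
   computed by splitting off the innermost arc. *)
Fixpoint nest i j :=
  if i is i'.+1 then
    maxn (nest i' j) (\max_(q < N | (j <= q) && S i' q) (nest i' q.+1).+1)
  else 0.

Definition shape i j := (arc_count i j, nest i j).

(** For [i <= j] the openers precede the closers automatically, so this excludes 3-crossings from
    the rectangle of (i, j). *)
Definition crossing_free i j := forall p1 p2 p3 q1 q2 q3,
  p1 < p2 -> p2 < p3 -> p3 < i -> j <= q1 -> q1 < q2 -> q2 < q3 ->
  S p1 q1 -> S p2 q2 -> S p3 q3 -> False.

Record partial_matching : Prop := PartialMatching {
  pm_lt : forall p q, S p q -> p < q < N;
  pm_row : forall p q q', S p q -> S p q' -> q = q';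
  pm_col : forall p p' q, S p q -> S p' q -> p = p' }.

Lemma nest_mono i i' j j' : i <= i' -> j' <= j -> nest i j <= nest i' j'.
Proof.
elim: i' i => [|i' IH] i; first by rewrite leqn0 => /eqP->.
case: (ltngtP i i'.+1) => // [lti _ lej | -> _ lej] /=.
  by apply: leq_trans (IH i lti lej) _; apply: leq_maxl.
rewrite geq_max (leq_trans (IH i' (leqnn _) lej)) ?leq_maxl //=.
apply/bigmax_leqP => q /andP[jq Sq].
apply: leq_trans (leq_maxr _ _).
by apply: (@leq_bigmax_cond _ _ (fun q : 'I_N => (nest i' q.+1).+1));
   rewrite Sq (leq_trans lej jq).
Qed.

Lemma nest_arc i j p q : S p q -> p < i -> j <= q < N -> nest p q.+1 < nest i j.
Proof.
move=> Spq ltpi /andP[jq qN].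
apply: leq_trans (nest_mono ltpi (leqnn j)) => /=.
apply: leq_trans (leq_maxr _ _).
by apply: (@leq_bigmax_cond _ _ (fun q : 'I_N => (nest p q.+1).+1) (Ordinal qN));
   rewrite /= jq.
Qed.

(** The arc found is the innermost one of a largest nest: it attains the maximum in the recursion,
    and the other [a] arcs enclose it. *)
Lemma nest_last i j a : nest i j = a.+1 ->
  exists p q, [/\ S p q, p < i, j <= q < N & nest p q.+1 = a].
Proof.
elim: i => //= i IH; set m := \max_(q < N | _) _ => E.
have : nest i j = a.+1 \/ a < m by lia.
case=> [/IH [p [q [H1 H2 H3 H4]]]|le].
  by exists p, q; split=> //; apply: ltnW.
have [/existsP[q /andP[/andP[jq Sq] ge]]|none] := 
  boolP [exists q : 'I_N, ((j <= q) && S i q) && (a < (nest i q.+1).+1)].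
  exists i, q; split=> //; first by rewrite jq ltn_ord.
  have : nest i q.+1 < nest i.+1 j by apply: nest_arc; rewrite ?jq /=.
  by rewrite /= -/m E; lia.
suff: m <= a by lia.
apply/bigmax_leqP => q jq; rewrite leqNgt; apply: contra none => H.
by apply/existsP; exists q; rewrite jq.
Qed.

(** * Row and column recursions for partial matchings *)

Hypothesis pm : partial_matching.

Lemma row_hitP i j : reflect (exists2 q, j <= q & S i q) (row_hit i j).
Proof.
apply: (iffP hasP) => [[q _ /andP[jq Sq]]|[q jq Sq]]; first by exists q.
exists q; last by rewrite jq.
by rewrite mem_iota; case/andP: (pm_lt pm Sq).
Qed.

Lemma col_hitP i j : reflect (exists2 p, p < i & S p j) (col_hit i j).
Proof.
apply: (iffP hasP) => [[p + Sp]|[p pi Sp]]; first by rewrite mem_iota; exists p.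
by exists p; rewrite // mem_iota.
Qed.

Lemma row_hit_step i j : row_hit i j = S i j + row_hit i j.+1 :> nat.
Proof.
case: (boolP (S i j)) => Sij.
  have -> : row_hit i j by apply/row_hitP; exists j.
  suff -> : row_hit i j.+1 = false by [].
  apply/row_hitP => -[q jq Sq]; move: (pm_row pm Sij Sq); lia.
rewrite add0n; congr nat_of_bool.
apply/row_hitP/row_hitP => -[q jq Sq]; exists q => //; last exact: ltnW.
by rewrite ltn_neqAle jq andbT; apply: contraNneq Sij => ->.
Qed.

Lemma col_hitS i j : col_hit i.+1 j = col_hit i j + S i j :> nat.
Proof.
case: (boolP (S i j)) => Sij.
  have -> : col_hit i.+1 j by apply/col_hitP; exists i.
  suff -> : col_hit i j = false by [].
  apply/col_hitP => -[p pi Sp]; move: (pm_col pm Sij Sp); lia.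
rewrite addn0; congr nat_of_bool.
apply/col_hitP/col_hitP => -[p pi Sp]; exists p => //; last exact: ltnW.
by move: pi; rewrite ltnS leq_eqVlt => /orP[/eqP e|//]; rewrite e (negPf Sij) in Sp.
Qed.

(** The definition counts by openers; this is the matching recursion by closers. *)
Lemma arc_count_col i j : arc_count i j = arc_count i j.+1 + col_hit i j.
Proof.
elim: i => //= i IH; rewrite row_hit_step IH col_hitS; lia.
Qed.

Lemma nest_row_none i j : ~~ row_hit i j -> nest i.+1 j = nest i j.
Proof.
move=> h /=; rewrite big_pred0 ?maxn0 // => q.
by apply: contraNF h => /andP[jq Sq]; apply/row_hitP; exists q.
Qed.

Lemma nest_row i j q : S i q -> j <= q ->
  nest i.+1 j = maxn (nest i j) (nest i q.+1).+1.
Proof.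
move=> Sq jq; have /andP[_ qN] := pm_lt pm Sq.
rewrite /= (big_pred1 (Ordinal qN)) // => q'.
apply/andP/eqP => [[jq' Sq']|-> //]; apply: val_inj => /=; exact: (pm_row pm Sq' Sq).
Qed.

Lemma nest_col_none i j : ~~ col_hit i j -> nest i j = nest i j.+1.
Proof.
move=> h; apply/eqP; rewrite eqn_leq andbC nest_mono //=.
case E: (nest i j) => [|a] //.
have [p [q [Spq pi /andP[jq qN] <-]]] := nest_last E.
apply: nest_arc => //; rewrite qN andbT ltn_neqAle jq andbT.
by apply: contraNneq h => ->; apply/col_hitP; exists p.
Qed.

(** The recursion for [nest] runs over openers only, so the column rule goes through the innermost
    arc of a largest nest: either it closes at [j] and is (p, j), or it closes later. *)
Lemma nest_col i j p : S p j -> p < i ->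
  nest i j = maxn (nest i j.+1) (nest p j.+1).+1.
Proof.
move=> Sp pi; have /andP[_ jN] := pm_lt pm Sp.
apply/eqP; rewrite eqn_leq geq_max nest_mono //= nest_arc ?leqnn ?jN // !andbT.
case E: (nest i j) => [|a] //.
have [p' [q [Spq p'i /andP[jq qN] <-]]] := nest_last E.
move: jq; rewrite leq_eqVlt => /orP[/eqP e|jq].
  subst q; rewrite (pm_col pm Spq Sp); exact: leq_maxr.
by rewrite leq_max nest_arc // jq qN.
Qed.

(* A pair (s, l) stands for a two-row shape of size s with first row l, so a box
   goes either to the second row (l is unchanged) or to the first. *)
Definition add_box (A B : nat * nat) :=
  B.1 = A.1.+1 /\ (B.2 = A.2 \/ B.2 = A.2.+1).

Definition cover_or_eq (A B : nat * nat) := A = B \/ add_box A B.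

(* Fomin's local rules with at most two rows.  A, B, C, D are the shapes at
   (i, j + 1), (i + 1, j + 1), (i, j), (i + 1, j), and r tells whether (i, j) is
   an arc.  The case B = C = A + (box in row 2) is absent since it would put a
   box in row 3 of D. *)
Definition growth (A B C D : nat * nat) (r : bool) :=
  if r then [/\ A = B, A = C & D = (A.1.+1, A.2.+1)]
  else [\/ A = C /\ D = B, A = B /\ D = C |
    [/\ B.1 = A.1.+1, C.1 = A.1.+1, D = (A.1.+2, A.2.+1) & maxn B.2 C.2 = A.2.+1]].

(** A row contributes at most one arc, and the arcs enclosing it already form a nest at (i, j), so
    the nest size grows by at most one. *)
Lemma shape_cover_row i j : cover_or_eq (shape i j) (shape i.+1 j).
Proof.
case: (boolP (row_hit i j)) => h; last first.
  by left; rewrite /shape nest_row_none //= (negPf h) addn0.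
case/row_hitP: (h) => q jq Sq.
right; rewrite /shape (nest_row Sq jq) /= h addn1; split=> //=.
have : nest i q.+1 <= nest i j by apply: nest_mono; lia.
lia.
Qed.

Lemma shape_cover_col i j : cover_or_eq (shape i j.+1) (shape i j).
Proof.
case: (boolP (col_hit i j)) => h; last first.
  by left; rewrite /shape (nest_col_none h) (arc_count_col i j) (negPf h) addn0.
case/col_hitP: (h) => p pi Sp.
right; rewrite /shape (nest_col Sp pi) (arc_count_col i j) h addn1 /=; split=> //=.
have : nest p j.+1 <= nest i j.+1 by apply: nest_mono; lia.
lia.
Qed.

(** An arc (i, j) is alone in its row and column. Otherwise the first two rules cover an empty
    column [j] or an empty row [i]; only when both contain an arc does the absence of 3-crossings
    enter. *)
Lemma shape_growth i j : i < j -> crossing_free i.+1 j ->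
  growth (shape i j.+1) (shape i.+1 j.+1) (shape i j) (shape i.+1 j) (S i j).
Proof.
move=> ij cf; case: (boolP (S i j)) => [Sij|nSij].
  have hr : ~~ row_hit i j.+1.
    by apply/row_hitP => -[q jq Sq]; move: (pm_row pm Sij Sq); lia.
  have hc : ~~ col_hit i j.
    by apply/col_hitP => -[q jq Sq]; move: (pm_col pm Sij Sq); lia.
  have h : row_hit i j by apply/row_hitP; exists j.
  rewrite /= /shape (nest_row Sij (leqnn j)) (nest_row_none hr) (nest_col_none hc) /=.
  rewrite (arc_count_col i j) (negPf hc) (negPf hr) h !addn0 addn1; split=> //.
  by congr pair; lia.
have [hr|hr] := boolP (row_hit i j.+1); last first.
  constructor 2; have hr' : ~~ row_hit i j.
    by move: (row_hit_step i j) hr; rewrite (negPf nSij); case: row_hit; case: row_hit.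
  by rewrite /shape !nest_row_none //= (negPf hr) (negPf hr') !addn0.
have [hc|hc] := boolP (col_hit i j); last first.
  constructor 1; have hc' : ~~ col_hit i.+1 j.
    by move: (col_hitS i j) hc; rewrite (negPf nSij); case: col_hit; case: col_hit.
  rewrite /shape !(nest_col_none hc) !(nest_col_none hc') !(arc_count_col _ j).
  by rewrite (negPf hc) (negPf hc') !addn0.
constructor 3.
case/row_hitP: (hr) => y jy Sy; case/col_hitP: (hc) => x xi Sx.
have hr' : row_hit i j by apply/row_hitP; exists y => //; apply: ltnW.
have key : maxn (nest i j.+1) (maxn (nest i y.+1).+1 (nest x j.+1).+1) = (nest i j.+1).+1.
  have H1 : nest i y.+1 <= nest i j.+1 by apply: nest_mono; lia.
  have H2 : nest x j.+1 <= nest i j.+1 by apply: nest_mono; lia.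
  (* A largest nest at (i, j + 1) can be extended by (i, y) or by (x, j):
     otherwise its innermost arc forms a 3-crossing with these two arcs. *)
  suff : (nest i j.+1 <= nest i y.+1) || (nest i j.+1 <= nest x j.+1) by lia.
  case E: (nest i j.+1) => [|a] //.
  have [p [q [Spq pi /andP[jq qN] Ea]]] := nest_last E.
  have npx : p <> x by move=> e; subst p; move: (pm_row pm Spq Sx); lia.
  have nqy : q <> y by move=> e; subst q; move: (pm_col pm Spq Sy); lia.
  have [px|px] := ltnP p x.
    have : nest p q.+1 < nest x j.+1 by apply: nest_arc; rewrite ?jq.
    lia.
  have [yq|yq] := ltnP y q.
    have : nest p q.+1 < nest i y.+1 by apply: nest_arc; rewrite ?yq.
    lia.
  exfalso; apply: (cf x p i j q y) => //; lia.
move: key.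
rewrite /shape (nest_row Sy (ltnW jy)) (nest_row Sy jy) (nest_col Sx xi) /=.
rewrite (arc_count_col i j) hr hc hr' !addn1 => key; split=> //; last by lia.
by congr pair; lia.
Qed.

(** A 3-crossing new at (i + 1, j) consists of (p1, j), (p2, q2) and (i, q3). By the last hypothesis
    the arcs around (i, q3) or around (p1, j) contain a nest as large as any at (i, j + 1); its
    innermost arc produces a 3-crossing that was already excluded. *)
Lemma crossing_free_step i j : i < j ->
  crossing_free i j -> crossing_free i.+1 j.+1 ->
  (forall x y, x < i -> j < y -> S x j -> S i y ->
     nest i j.+1 < maxn (nest i.+1 j.+1) (nest i j)) ->
  crossing_free i.+1 j.
Proof.
move=> ij cfC cfB H p1 p2 p3 q1 q2 q3 l1 l2 l3 l4 l5 l6 S1 S2 S3.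
have [l3'|l3'] := ltnP p3 i; first exact: (cfC p1 p2 p3 q1 q2 q3).
have [l4'|l4'] := ltnP j q1; first exact: (cfB p1 p2 p3 q1 q2 q3).
have e3 : p3 = i by lia. have e1 : q1 = j by lia.
subst p3 q1; have xi : p1 < i by lia. have jy : j < q3 by lia.
have /andP[_ q2N] := pm_lt pm S2. have /andP[_ q3N] := pm_lt pm S3.
move: (H _ _ xi jy S1 S3); rewrite (nest_row S3 jy) (nest_col S1 xi).
have h2 : nest p2 q2.+1 < nest i j.+1 by apply: nest_arc; rewrite ?l5.
(* Let (p, q) be innermost in a largest nest around (i, q3). If [p2 < p], it crosses (p1, j) and
   (p2, q2); otherwise it encloses (p2, q2), which allows one arc more than the maximum at (i, j +
   1). *)
have [|lt1] := leqP (nest i j.+1) (nest i q3.+1).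
  case E: (nest i q3.+1) => [|a] le; first by lia.
  have [p [q [Spq pi /andP[yq qN] Ea]]] := nest_last E.
  have np : p <> p2 by move=> e; subst p; move: (pm_row pm Spq S2); lia.
  have [p2p|pp2] := ltnP p2 p; first by case: (cfC p1 p2 p j q2 q) => //; lia.
  have : nest p q.+1 < nest p2 q2.+1 by apply: nest_arc; rewrite ?qN; lia.
  lia.
(* The transposed argument: the innermost arc around (p1, j) crosses (p2, q2) and (i, q3), or
   encloses (p2, q2). *)
have [|lt2] := leqP (nest i j.+1) (nest p1 j.+1); last by lia.
case E: (nest p1 j.+1) => [|a] le; first by lia.
have [p [q [Spq pi /andP[yq qN] Ea]]] := nest_last E.
have nq : q <> q2 by move=> e; subst q; move: (pm_col pm Spq S2); lia.
have [q2q|qq2] := ltnP q q2; first by case: (cfB p p2 i q q2 q3) => //; lia.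
have : nest p q.+1 < nest p2 q2.+1 by apply: nest_arc; rewrite ?qN; lia.
lia.
Qed.

Lemma shape_colN i j : N <= j -> shape i j = (0, 0).
Proof.
move=> Nj; elim: i => //= i [e1 e2].
have h : ~~ row_hit i j.
  by apply/row_hitP => -[q jq Sq]; case/andP: (pm_lt pm Sq); lia.
by rewrite /shape nest_row_none //= (negPf h) e1 e2.
Qed.

End Arcs.

(** * Growth tables *)

(** For a pair (s, l) this says that (l, s - l) is a partition. *)
Definition two_row (A : nat * nat) := A.2 <= A.1 <= A.2 + A.2.

(* In the last case lambda_A is lambda_B meet lambda_C, or lambda_B minus a box of
   row 1 when they are equal; both have size s_D - 2 and first row l_D - 1. *)
Definition backward (B C D : nat * nat) :=
  if D.1 == B.1 then C else if D.1 == C.1 then B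
  else if maxn B.2 C.2 < D.2 then B else (D.1 - 2, D.2 - 1).

(** Between covering shapes the three tests force B = C with D larger by a box in row 1, the only
    configuration that yields an arc. *)
Definition rook (B C D : nat * nat) :=
  [&& D.1 != B.1, D.1 != C.1 & maxn B.2 C.2 < D.2].

(** The conclusions restore the hypotheses for the new corner, so the rule can be iterated away from
    the diagonal. *)
Lemma backward_growth B C D : two_row B -> two_row C -> two_row D ->
  cover_or_eq B D -> cover_or_eq C D ->
  [/\ growth (backward B C D) B C D (rook B C D), two_row (backward B C D),
      cover_or_eq (backward B C D) B & cover_or_eq (backward B C D) C].
Proof.
case: B C D => [b1 b2] [c1 c2] [d1 d2].
rewrite /two_row /cover_or_eq /add_box /growth /backward /rook /=.
move=> hB hC hD cB cC.
case: eqP => [e1|n1] /=.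
  have [? ?] : d1 = b1 /\ d2 = b2 by case: cB => [[]|]; lia.
  by subst; split; [constructor 1 | | | left].
case: eqP => [e2|n2] /=.
  have [? ?] : d1 = c1 /\ d2 = c2 by case: cC => [[]|]; lia.
  by subst; split; [constructor 2 | | left | ].
case: cB => [[]|cB]; first lia. case: cC => [[]|cC]; first lia.
case h: (maxn b2 c2 < d2).
  have [? [? ?]] : d1 = b1.+1 /\ c1 = b1 /\ c2 = b2 by lia.
  have ? : d2 = b2.+1 by lia.
  by subst; split; [ | | left | left].
(* Here B or C is D minus a box of row 2, so D has two nonempty rows and both truncated subtractions
   are exact. *)
split; first by constructor 3; split=> /=; try lia; congr pair; lia.
- by rewrite /=; lia.
- by right; split=> /=; lia.
by right; split=> /=; lia.
Qed.

Lemma growth_backward A B C D r :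
  cover_or_eq A B -> cover_or_eq A C -> cover_or_eq B D -> cover_or_eq C D ->
  growth A B C D r ->
  A = backward B C D /\ r = rook B C D.
Proof.
case: A B C D => [a1 a2] [b1 b2] [c1 c2] [d1 d2].
rewrite /cover_or_eq /add_box /growth /backward /rook /= => cAB cAC cBD cCD.
case: r => [[[<- <-] [<- <-] [-> ->]]|].
  by rewrite maxnn ltnSn !gtn_eqF.
case=> [[[<- <-] [-> ->]]|[[<- <-] [-> ->]]|[-> -> [-> ->] e]].
- by rewrite eqxx.
- case: eqP => /= [e|_]; last by rewrite eqxx.
  by case: cAC => [[-> ->]|] //; lia.
have -> : (a1.+2 == a1.+1) = false by lia.
by rewrite e ltnn !subSS !subn0.
Qed.

(** The forward rule is deterministic; this later identifies the shapes of the constructed matching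
    with the table entries. *)
Lemma growth_det A B C D D' r :
  growth A B C D r -> growth A B C D' r -> D = D'.
Proof.
case: A B C D D' => [a1 a2] [b1 b2] [c1 c2] [d1 d2] [e1 e2].
rewrite /growth /=; case: r; first by move=> [_ _ ->] [_ _ ->].
case=> [[[<- <-] [-> ->]]|[[<- <-] [-> ->]]|[-> -> [-> ->] e]] //.
- case=> [[_ ->]|[[<- <-] [-> ->]]|] //; case; lia.
- case=> [[[<- <-] [-> ->]]|[_ ->]|] //; case; lia.
case=> [[[]]|[[]]|[_ _ ->]] //; lia.
Qed.

Lemma growth_two_row A B C D r : two_row A -> two_row B -> two_row C ->
  growth A B C D r -> two_row D.
Proof.
case: A B C D => [a1 a2] [b1 b2] [c1 c2] [d1 d2].
rewrite /two_row /growth /= => hA hB hC.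
case: r; first by move=> [_ _ [-> ->]]; lia.
case=> [[_ [-> ->]]|[_ [-> ->]]|[eb ec [-> ->] e]] //; lia.
Qed.

(** The order in which forward growth fills the triangle: from the edges [i = 0] and [j >= N]
    towards the diagonal, each cell after its three outer neighbours. *)
Lemma region_ind N (P : nat -> nat -> Prop) :
  (forall j, P 0 j) -> (forall i j, i <= j -> N <= j -> P i j) ->
  (forall i j, i < j < N -> P i j.+1 -> P i.+1 j.+1 -> P i j -> P i.+1 j) ->
  forall i j, i <= j -> P i j.
Proof.
move=> P0 PN PS; elim=> // i IH j.
have [m] := ubnP (N - j); elim: m j => // m IHm j ltm ij.
have [Nj|jN] := leqP N j; first exact: PN.
by apply: PS; [rewrite ij | apply: IH; lia | apply: IHm; lia | apply: IH; lia].
Qed.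

(** * Matchings without 3-crossings and their diagonals *)

Section Table.
Variables (N : nat) (w : nat -> bool).

(** The admissible diagonals: oscillating tableaux with at most two rows, where [w] tells which
    steps add a box. *)
Record boundary (b : nat -> nat * nat) : Prop := Boundary {
  boundary0 : b 0 = (0, 0);
  boundaryN : b N = (0, 0);
  boundary_two_row : forall i, i <= N -> two_row (b i);
  boundary_step : forall i, i < N ->
    if w i then add_box (b i) (b i.+1) else add_box (b i.+1) (b i) }.

Record perfect (S : rel nat) : Prop := Perfect {
  perfect_pm :> partial_matching N S;
  perfect_word : forall p q, S p q -> w p && ~~ w q;
  perfect_opener : forall p, p < N -> w p -> exists q, S p q;
  perfect_closer : forall q, q < N -> ~~ w q -> exists p, S p q;
  perfect_crossing : forall i, crossing_free S i i }.

(** The three arcs all pass over the point [q1] unless [p3 = q1], and no step is both an opener and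
    a closer. *)
Lemma perfect_crossing_free S i j : perfect S -> i <= j.+1 -> crossing_free S i j.
Proof.
move=> pS ij p1 p2 p3 q1 q2 q3 ? ? ? ? ? ? S1 S2 S3.
have ? : p3 < q3 by case/andP: (pm_lt pS S3).
have [e|ne] := eqVneq p3 q1; last by apply: (perfect_crossing pS (i := q1)) S1 S2 S3; lia.
by subst q1; move: (perfect_word pS S1) (perfect_word pS S3); case: (w p3); rewrite ?andbF.
Qed.

Lemma perfect_growth S i j : perfect S -> i < j ->
  growth (shape N S i j.+1) (shape N S i.+1 j.+1) (shape N S i j)
         (shape N S i.+1 j) (S i j).
Proof.
move=> pS ij; apply: (shape_growth pS ij); apply: perfect_crossing_free => //; lia.
Qed.

Lemma perfect_two_row S i j : perfect S -> i <= j -> two_row (shape N S i j).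
Proof.
move=> pS; move: i j; apply: (@region_ind N) => // [i j _ Nj|i j /andP[ij _] hA hB hC].
  by rewrite (shape_colN pS).
exact: growth_two_row hA hB hC (perfect_growth pS ij).
Qed.

(** An opener leaves column [i] empty and a closer leaves row [i] empty, so the entry beside the
    diagonal copies one of its two diagonal neighbours. *)
Lemma shape_next S i : perfect S ->
  shape N S i i.+1 = if w i then shape N S i i else shape N S i.+1 i.+1.
Proof.
move=> pS; case: ifP => wi.
  have h : ~~ col_hit S i i.
    by apply/col_hitP => -[p _ /(perfect_word pS)]; rewrite wi andbF.
  by rewrite /shape (nest_col_none N h) (arc_count_col pS i i) (negPf h) addn0.
have h : ~~ row_hit N S i i.+1.
  by apply/(row_hitP pS) => -[p _ /(perfect_word pS)]; rewrite wi.
by rewrite /shape (nest_row_none pS) //= (negPf h) addn0.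
Qed.

Lemma perfect_boundary S : perfect S -> boundary (fun i => shape N S i i).
Proof.
move=> pS; split=> // [|i _|i iN]; first by rewrite (shape_colN pS).
  exact: perfect_two_row.
have := shape_next i pS; case: ifP => wi e.
  have := shape_cover_row pS i i.+1; rewrite e => -[ec|//].
  have [q Sq] := perfect_opener pS iN wi.
  have h : row_hit N S i i.+1.
    by apply/(row_hitP pS); exists q => //; case/andP: (pm_lt pS Sq).
  by case: e ec => e1 _ []; rewrite /= h e1; lia.
have := shape_cover_col pS i i; rewrite e => -[ec|//].
have [p Sp] := perfect_closer pS iN (negbT wi).
have h : col_hit S i i.
  by apply/col_hitP; exists p => //; case/andP: (pm_lt pS Sp).
by rewrite -e in ec; case: ec => + _; rewrite (arc_count_col pS i i) h; lia.
Qed.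

(* [table_rec b d i] is the entry at (i, i + d) of the table with diagonal b. *)
Fixpoint table_rec (b : nat -> nat * nat) d i :=
  match d with
  | 0 => b i
  | d1.+1 => match d1 with
    | 0 => if w i then b i else b i.+1
    | d2.+1 => backward (table_rec b d1 i.+1) (table_rec b d1 i) (table_rec b d2 i.+1)
    end
  end.

Definition table b i j := table_rec b (j - i) i.

Lemma table_diag b i : table b i i = b i.
Proof. by rewrite /table subnn. Qed.

Lemma table_next b i : table b i i.+1 = if w i then b i else b i.+1.
Proof. by rewrite /table subSnn. Qed.

Lemma table_back b i j : i < j ->
  table b i j.+1 = backward (table b i.+1 j.+1) (table b i j) (table b i.+1 j).
Proof.
move=> ij; rewrite /table subSS.
have -> : j.+1 - i = (j - i.+1).+2 by lia.
by have -> : j - i = (j - i.+1).+1 by lia.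
Qed.

Definition table_rook b p q :=
  [&& p < q, q < N & rook (table b p.+1 q.+1) (table b p q) (table b p.+1 q)].

(** By induction on the distance from the diagonal, uniqueness of the backward rule forces every
    entry to be the true shape; the same rule then reads off each arc. *)
Lemma perfect_table b S : perfect S -> (forall i, i <= N -> shape N S i i = b i) ->
  S =2 table_rook b.
Proof.
move=> pS e.
have st d i : i + d <= N -> shape N S i (i + d) = table b i (i + d).
  have [m] := ubnP d; elim: m d i => // m IH [|[|d]] i ltm le.
  - by rewrite addn0 table_diag e //; lia.
  - by rewrite addn1 table_next shape_next // !e //; lia.
  rewrite addnS table_back; last by lia.
  have eB := IH d.+1 i.+1; rewrite addSn in eB.
  have eD := IH d i.+1; rewrite addSn -addnS in eD.
  rewrite -eB -?(IH d.+1 i) -?eD; try lia.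
  apply: (proj1 (growth_backward _ _ _ _ (perfect_growth pS _)));
    first [exact: (shape_cover_row pS) | exact: (shape_cover_col pS) | lia].
have st' i j : i <= j <= N -> shape N S i j = table b i j.
  by case/andP=> ij jN; rewrite -(subnKC ij) st // subnKC.
move=> p q; rewrite /table_rook.
have [pq|qp] := ltnP p q; last by apply/negP => /(pm_lt pS); lia.
have [qN|Nq] := ltnP q N; last by apply/negP => /(pm_lt pS); lia.
rewrite /= -!st' ?pq ?qN //; try lia.
apply: (proj2 (growth_backward _ _ _ _ (perfect_growth pS _)));
  first [exact: (shape_cover_row pS) | exact: (shape_cover_col pS) | lia].
Qed.

(** Nest sizes on the diagonal suffice, because the arc counts there are dictated by [w]. *)
Lemma perfect_inj S S' : perfect S -> perfect S' ->
  (forall i, i <= N -> nest N S i i = nest N S' i i) -> S =2 S'.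
Proof.
move=> pS pS' e p q.
rewrite (perfect_table (b := fun i => shape N S i i) pS) //.
rewrite (perfect_table (b := fun i => shape N S i i) pS') //.
elim=> [|i IH] iN; first by [].
have [_ _ _ /(_ i iN)] := perfect_boundary pS.
have [_ _ _ /(_ i iN)] := perfect_boundary pS'.
move: (IH (ltnW iN)) (e _ iN); rewrite /shape /add_box; case: (w i) => /= -[e1 e2] <-.
  by move=> [-> _] [-> _]; rewrite e1.
by move=> [h _] [h' _]; congr pair; lia.
Qed.

(** * Reconstruction of a matching from an admissible diagonal *)

Section Construct.
Variable b : nat -> nat * nat.
Hypothesis hb : boundary b.

Lemma table_valid i j : i <= j <= N -> [/\ two_row (table b i j),
  i < j -> cover_or_eq (table b i j) (table b i j.-1) &
  i < j -> cover_or_eq (table b i j) (table b i.+1 j)].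
Proof.
case/andP=> ij; rewrite -(subnKC ij); move: (j - i) => d {ij}.
have [m] := ubnP d; elim: m d i => // m IH [|[|d]] i ltm le.
- by rewrite addn0 table_diag ltnn; split=> //; apply: (boundary_two_row hb); lia.
- have iN : i < N by lia.
  rewrite addn1 table_next table_diag /= table_diag.
  have := boundary_step hb iN; case: (w i) => h; split=> //.
  + by apply: (boundary_two_row hb); lia.
  + by left.
  + by right.
  + by apply: (boundary_two_row hb); lia.
  + by right.
  by left.
rewrite addnS table_back; last by lia.
have [||h1 h2 h3] := IH d.+1 i; try lia.
have [||h4 h5 h6] := IH d.+1 i.+1; try lia.
have [||h7 _ _] := IH d i.+1; try lia.
rewrite /= addnS in h1 h2 h3; rewrite /= addSn addnS /= in h4 h5 h6; rewrite addSn in h7.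
rewrite addnS.
by case: (@backward_growth _ _ _ h4 h1 h7) => //; [apply: h5|apply: h3]; lia.
Qed.

Lemma table_two_row i j : i <= j <= N -> two_row (table b i j).
Proof. by case/table_valid. Qed.

Lemma table_cover_col i j : i <= j < N -> cover_or_eq (table b i j.+1) (table b i j).
Proof. by case/andP=> ij jN; have [|_ h _] := @table_valid i j.+1; try lia; exact: h. Qed.

Lemma table_cover_row i j : i < j <= N -> cover_or_eq (table b i j) (table b i.+1 j).
Proof. by case/andP=> ij jN; have [|_ _ h] := @table_valid i j; try lia; exact: h. Qed.

Lemma table_growth i j : i < j < N ->
  growth (table b i j.+1) (table b i.+1 j.+1) (table b i j) (table b i.+1 j)
         (table_rook b i j).
Proof.
case/andP=> ij jN; rewrite table_back // /table_rook ij jN /=.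
by case: (@backward_growth (table b i.+1 j.+1) (table b i j) (table b i.+1 j)) => //;
  first [apply: table_two_row | apply: table_cover_row | apply: table_cover_col]; lia.
Qed.

(** Entries only lose boxes when moving away from the diagonal, so an edge that starts at the empty
    shape stays empty. *)
Lemma table_row0 j : j <= N -> table b 0 j = (0, 0).
Proof.
elim: j => [|j IH] jN; first by rewrite table_diag (boundary0 hb).
have := @table_cover_col 0 j jN; rewrite IH ?(ltnW jN) //.
by move=> [//|[]].
Qed.

Lemma table_colN i : i <= N -> table b i N = (0, 0).
Proof.
move=> iN; rewrite -(subKn iN); move: (N - i) (leq_subr i N) => d {i iN}.
elim: d => [|d IH] dN; first by rewrite subn0 table_diag (boundaryN hb).
have h : N - d.+1 < N <= N by lia.
by have := table_cover_row h; rewrite subnSK // IH ?(ltnW dN) //; case=> [|[]].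
Qed.

(** Every local rule gives |D| - |B| = |C| - |A| + r. The size difference across column [j] thus
    starts at 0 and rises by one at a rook; a rook requires A = C, so a second one is impossible. *)
Lemma table_col i j : i <= j < N ->
  (table b i j).1 = (table b i j.+1).1 + col_hit (table_rook b) i j /\
  (forall p q, p < i -> q < i -> table_rook b p j -> table_rook b q j -> p = q).
Proof.
case/andP; elim: i => [|i IH] ij jN; first by rewrite !table_row0 //; lia.
have [e u] := IH (ltnW ij) jN.
have := table_growth (i := i) (j := j); rewrite ij jN => /(_ isT) g.
have hitS : col_hit (table_rook b) i.+1 j = col_hit (table_rook b) i j || table_rook b i j.
  by rewrite /col_hit -addn1 iotaD has_cat /= orbF.
rewrite hitS; case: (boolP (table_rook b i j)) g => r g.
  have h : ~~ col_hit (table_rook b) i j.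
    by move: e; case: g => _ <- _; case: col_hit => //; lia.
  rewrite orbT; case: g => <- _ -> /=; split; first by lia.
  move=> p q; rewrite !ltnS (leq_eqVlt p) (leq_eqVlt q).
  case/orP=> [/eqP->|pi]; case/orP=> [/eqP->|qi] // rp rq; first 1 last.
  - by case/hasP: h; exists p; rewrite // mem_iota.
  - exact: u.
  by case/hasP: h; exists q; rewrite // mem_iota.
rewrite orbF; split; last first.
  move=> p q; rewrite !ltnS (leq_eqVlt p) (leq_eqVlt q).
  case/orP=> [/eqP->|pi]; case/orP=> [/eqP->|qi] //; rewrite ?(negPf r) //.
  exact: u.
case: g => [[g1 g2]|[g1 g2]|[g1 g2 g3 _]].
- by rewrite g2; rewrite g1 in e; lia.
- by rewrite g2 -g1.
by move: e; rewrite g2 g3 g1 /=; lia.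
Qed.

Lemma table_row i j : i < j <= N ->
  (table b i.+1 j).1 = (table b i j).1 + row_hit N (table_rook b) i j /\
  (forall p q, j <= p -> j <= q -> table_rook b i p -> table_rook b i q -> p = q).
Proof.
(* Induction on [N - j], starting from the edge [j = N], where all entries are empty. *)
case/andP=> ij jN; rewrite -(subKn jN); move: (N - j) (leq_subr j N) (subKn jN) => d.
have {ij}: i < j by [].
move=> + + e; rewrite -e {jN e j}.
elim: d => [|d IH] ij dN.
  rewrite subn0 in ij *; rewrite !table_colN; try lia; split; last first.
    by move=> p q Np _ /and3P[_]; lia.
  suff -> : row_hit N (table_rook b) i N = false by [].
  by apply/hasP => -[q _ /andP[? /and3P[]]]; lia.
set j := N - d.+1 in ij *; have ej : N - d = j.+1 by lia.
clearbody j.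
have jN : j < N by lia.
rewrite ej in IH; have [e u] := IH (ltnW ij) (ltnW dN).
have := table_growth (i := i) (j := j); rewrite ij jN => /(_ isT) g.
have hitS : row_hit N (table_rook b) i j = row_hit N (table_rook b) i j.+1 || table_rook b i j.
  apply/hasP/orP => [[q qN /andP[jq rq]]|[/hasP[q qN /andP[jq rq]]|r]].
  - have [e1|ne] := eqVneq j q; first by right; rewrite e1.
    by left; apply/hasP; exists q; rewrite // ltn_neqAle ne jq.
  - by exists q; rewrite // (ltnW jq).
  by exists j; rewrite ?mem_iota ?leqnn.
rewrite hitS; case: (boolP (table_rook b i j)) g => r g.
  have h : ~~ row_hit N (table_rook b) i j.+1.
    by move: e; case: g => <- _ _; case: row_hit => //; lia.
  rewrite orbT; case: g => _ <- -> /=; split; first by lia.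
  move=> p q; rewrite (leq_eqVlt j) (leq_eqVlt j q).
  case/orP=> [/eqP<-|pi]; case/orP=> [/eqP<-|qi] // rp rq; first 1 last.
  - by case/hasP: h; exists p; rewrite ?pi //; case/and3P: rp; rewrite mem_iota.
  - exact: u.
  by case/hasP: h; exists q; rewrite ?qi //; case/and3P: rq; rewrite mem_iota.
rewrite orbF; split; last first.
  move=> p q; rewrite (leq_eqVlt j) (leq_eqVlt j q).
  case/orP=> [/eqP<-|pi]; case/orP=> [/eqP<-|qi] //; rewrite ?(negPf r) //.
  exact: u.
case: g => [[g1 g2]|[g1 g2]|[g1 g2 g3 _]].
- by rewrite g2 -g1.
- by rewrite g2; rewrite g1 in e; lia.
by move: e; rewrite g2 g3 g1 /=; lia.
Qed.

Lemma table_pm : partial_matching N (table_rook b).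
Proof.
split=> [p q /and3P[-> ->] //|p q q' r r'|p p' q r r'].
  case/and3P: (r) => pq qN _; case/and3P: (r') => pq' qN' _.
  have [|_ u] := @table_row p (minn q q'); first by lia.
  by apply: u => //; rewrite geq_min leqnn ?orbT.
case/and3P: (r) => pq qN _; case/and3P: (r') => pq' qN' _.
have [|_ u] := @table_col (maxn p p').+1 q; first by lia.
by apply: u => //; rewrite ltnS leq_max leqnn ?orbT.
Qed.

(** Both claims are proved together: forward growth of shapes needs the absence of 3-crossings, and
    its propagation needs the nest sizes at the three earlier corners. *)
Lemma table_shape i j : i <= j -> j <= N ->
  crossing_free (table_rook b) i j /\ shape N (table_rook b) i j = table b i j.
Proof.
have pm := table_pm.
move: i j; apply: (@region_ind N) => [j jN|i j ij Nj jN|i j /andP[ij jN]].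
- by rewrite table_row0.
- split; last by have -> : j = N by [lia]; rewrite (shape_colN pm) // table_colN //; lia.
  by move=> p1 p2 p3 q1 q2 q3 ? ? ? ? ? ? /and3P[]; lia.
move=> /(_ jN)[_ eA] /(_ jN)[cB eB] /(_ (ltnW jN)) [cC eC] _.
have g := table_growth (i := i) (j := j); rewrite ij jN in g; move/(_ isT) in g.
have c : crossing_free (table_rook b) i.+1 j.
  apply: (@crossing_free_step N) => // x y xi jy rx ry.
  have nr : ~~ table_rook b i j.
    by apply/negP => r; move: (pm_row pm r ry); lia.
  have hr : row_hit N (table_rook b) i j.+1 by apply/(row_hitP pm); exists y.
  have hc : col_hit (table_rook b) i j by apply/col_hitP; exists x.
  have eAB := arc_count_col pm i j; rewrite hc in eAB.
  have eAC : arc_count N (table_rook b) i.+1 j.+1 = (arc_count N (table_rook b) i j.+1).+1.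
    by rewrite /= hr addn1.
  rewrite (negPf nr) -eA -eB -eC in g.
  (* Row [i] and column [j] both contain arcs, so arc counts refute the first two rules; the third
     says that B or C has a larger nest than A. *)
  case: g => [[eC' _]|[eB' _]|[_ _ _ emax]].
  - have := congr1 fst eC'; rewrite -[LHS]/(arc_count N (table_rook b) i j.+1).
    by rewrite -[RHS]/(arc_count N (table_rook b) i j); lia.
  - have := congr1 fst eB'; rewrite -[LHS]/(arc_count N (table_rook b) i j.+1).
    by rewrite -[RHS]/(arc_count N (table_rook b) i.+1 j.+1); lia.
  by rewrite -[nest _ _ i.+1 _]/(shape N (table_rook b) i.+1 j.+1).2
     -[nest _ _ i j]/(shape N (table_rook b) i j).2 emax.
split=> //; apply: growth_det g.
by rewrite -eA -eB -eC; apply: shape_growth.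
Qed.

Lemma table_perfect : perfect (table_rook b).
Proof.
(* The entry at (i, i + 1) is the smaller of its two diagonal neighbours, so comparing sizes shows
   whether step [i] opens or closes an arc. *)
have opener i : i < N -> row_hit N (table_rook b) i i.+1 = w i.
  move=> iN; have [|e _] := @table_row i i.+1; first by rewrite leqnn.
  move: e; rewrite table_diag table_next; have := boundary_step hb iN.
  by case: (w i) => -[e _]; case: row_hit; lia.
have closer i : i < N -> col_hit (table_rook b) i i = ~~ w i.
  move=> iN; have [|e _] := @table_col i i; first by rewrite leqnn.
  move: e; rewrite table_diag table_next; have := boundary_step hb iN.
  by case: (w i) => -[e _]; case: col_hit; lia.
split; first exact: table_pm.
- move=> p q r; have /andP[pq qN] := pm_lt table_pm r.
  rewrite -opener -?closer; try lia.
  by apply/andP; split; [apply/(row_hitP table_pm); exists q|apply/col_hitP; exists p].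
- by move=> p pN; rewrite -opener // => /(row_hitP table_pm)[q _ r]; exists q.
- by move=> q qN; rewrite -closer // => /col_hitP[p _ r]; exists p.
move=> i; have [iN|Ni] := leqP i N; first by case: (@table_shape i i).
move=> p1 p2 p3 q1 q2 q3 _ _ _ iq l1 l2 /(pm_lt table_pm); lia.
Qed.

Lemma table_nest i : i <= N -> nest N (table_rook b) i i = (b i).2.
Proof. by move=> iN; rewrite -table_diag; case: (@table_shape i i) => // _ <-. Qed.

End Construct.
End Table.

(** * Dyck paths and admissible diagonals *)

Lemma eq_nest N S S' i j : S =2 S' -> nest N S i j = nest N S' i j.
Proof.
move=> e; elim: i j => //= i IH j; rewrite IH; congr maxn.
by apply: eq_big => q; rewrite ?e // IH.
Qed.

Section Paths.
Variable n : nat.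
Implicit Types p q : lpath n.

Definition steps p (i : nat) : bool := nth false p i.
Definition east p i := count_mem true (take i p).
Definition south p i := count_mem false (take i p).

Lemma east0 p : east p 0 = 0.
Proof. by rewrite /east take0. Qed.

Lemma eastS p i : i < n.*2 -> east p i.+1 = east p i + steps p i.
Proof.
move=> iN; rewrite /east (take_nth false) ?size_tuple // -cats1 count_cat /=.
by rewrite addn0 -/(steps p i); case: steps.
Qed.

Lemma east_south p i : i <= n.*2 -> east p i + south p i = i.
Proof.
move=> iN; have e : size (take i p) = i by rewrite size_takel ?size_tuple.
rewrite -[RHS]e -(count_predC (pred1 true) (take i p)) /east /south.
by congr (_ + _); apply: eq_count => -[].
Qed.

Lemma east_mono p i j : i <= j -> east p i <= east p j.
Proof.
by move=> ij; rewrite /east -(subnKC ij) takeD count_cat leq_addr.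
Qed.

Lemma south_mono p i j : i <= j -> south p i <= south p j.
Proof.
by move=> ij; rewrite /south -(subnKC ij) takeD count_cat leq_addr.
Qed.

Lemma heightE p i : i <= n.*2 -> height p i = ((east p i + east p i)%:Z - i%:Z)%R.
Proof.
elim: i => [|i IH] iN; first by rewrite east0.
rewrite /= IH ?(ltnW iN) // eastS // -/(steps p i).
by case: (steps p i) => /=; lia.
Qed.

Lemma dyckP p : reflect (east p n.*2 = n /\ forall i, i <= n.*2 -> i <= east p i + east p i)
  (is_dyck p).
Proof.
(* Bounding south counts by the final one makes the truncated subtraction in [vertex] exact. *)
have sm i : i <= n.*2 -> south p i <= south p n.*2 by exact: south_mono.
have es := east_south p.
apply: (iffP andP) => [[/eqP[e1 e2] /forallP H]|[e H]].
  rewrite -/(east p n.*2) in e1; rewrite -/(south p n.*2) in e2.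
  split=> // i iN; have := H (inord i).
  rewrite inordK // /vertex /= -/(east p i) -/(south p i).
  have := es i iN; have := sm i iN; have := es _ (leqnn n.*2); lia.
split.
  rewrite /vertex -/(east p n.*2) -/(south p n.*2) e.
  by have := es _ (leqnn n.*2); rewrite e => es'; apply/eqP; congr pair; lia.
apply/forallP => i; have iN : i <= n.*2 by rewrite -ltnS.
rewrite /vertex /= -/(east p i) -/(south p i).
have := es i iN; have := H i iN; have := sm i iN; have := es _ (leqnn n.*2); lia.
Qed.

Lemma vertexE p i : i <= n.*2 -> vertex p i = (east p i, n - (i - east p i)).
Proof.
move=> iN; have e := east_south p iN.
by rewrite /vertex -/(east p i) -/(south p i); congr pair; lia.
Qed.

Lemma east_ivt p i c : c <= east p i -> i <= n.*2 -> exists2 k, k <= i & east p k = c.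
Proof.
elim: i => [|i IH] ci iN; first by exists 0 => //; move: ci; rewrite east0; lia.
have [ci'|ci'] := leqP c (east p i).
  by have [k ki e] := IH ci' (ltnW iN); exists k => //; apply: leqW.
by exists i.+1 => //; move: ci ci'; rewrite eastS //; case: steps; lia.
Qed.

(** A vertex of [q] at step [k] on the vertical line through vertex [i] of [p] is at least as high
    exactly when [k <= i]. Such a [k] exists if and only if [q] has made at least as many east steps
    by time [i]. *)
Lemma never_aboveP p q : is_dyck p -> is_dyck q ->
  reflect (forall i, i <= n.*2 -> east p i <= east q i) (never_above p q).
Proof.
have bound r i : is_dyck r -> i <= n.*2 -> i - east r i <= n.
  case/dyckP=> e _ iN; have := east_south r iN; have := east_south r (leqnn n.*2).
  have := south_mono r iN.
  by rewrite e; lia.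
move=> dp dq; apply: (iffP forallP) => [H i iN|H i].
  have := H (inord i); rewrite inordK // => /forallPn[k].
  have kN : k <= n.*2 by rewrite -ltnS.
  rewrite !vertexE //= negb_imply -leqNgt => /andP[/eqP e le].
  rewrite -e; apply: east_mono; have := bound p i dp iN; have := bound q k dq kN.
  have := east_south p iN; have := east_south q kN; lia.
have iN : i <= n.*2 by rewrite -ltnS.
have [k ki e] := east_ivt (H i iN) iN.
apply/forallPn; exists (inord k); have kN : k <= n.*2 by apply: leq_trans iN.
by rewrite inordK // !vertexE //= e eqxx /= -leqNgt; lia.
Qed.

Lemma dyck_height_inj p q :
  (forall i, i <= n.*2 -> height p i = height q i) -> p = q.
Proof.
move=> e; have e' i : i <= n.*2 -> east p i = east q i.
  by move=> iN; have := e i iN; rewrite !heightE //; lia.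
apply: val_inj; apply: (@eq_from_nth _ false); rewrite ?size_tuple // => i iN.
have := e' _ iN; rewrite !eastS // e' ?(ltnW iN) // /steps.
by case: nth; case: nth; lia.
Qed.

(** * Admissible diagonals as pairs of Dyck paths *)

Lemma boundary_fst (F : dyck n) b i : boundary n.*2 (steps (sval F)) b ->
  i <= n.*2 -> (b i).1 = east (sval F) i + east (sval F) i - i.
Proof.
move=> hb; have /dyckP[_ dF] := svalP F.
elim: i => [|i IH] iN; first by rewrite (boundary0 hb) east0.
have := boundary_step hb iN; have := IH (ltnW iN).
have := dF _ (ltnW iN); have := dF _ iN; rewrite eastS //.
by case: steps => /= ? ? ? []; lia.
Qed.

(** The second entry is l = (h + j) / 2, from j = 2l - h. With s = h, the condition l <= s says that
    the path lies weakly below [F], and s <= 2l says that j >= 0. *)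
Lemma boundary_of_pair (F : dyck n) (P : dyck_pairs F) :
  boundary n.*2 (steps (sval F)) (fun i =>
    (east (sval F) i + east (sval F) i - i, east (sval F) i + east (sval (sval P).1) i - i)).
Proof.
case: P => [[P G] /= /andP[/eqP/= -> /= /never_aboveP H]].
have {}H := H (svalP P) (svalP F).
have /dyckP[eF dF] := svalP F; have /dyckP[eP dP] := svalP P.
split=> [||i iN|i iN]; first by rewrite !east0.
- by rewrite eF eP -addnn subnn.
- by have := H i iN; have := dP i iN; have := dF i iN; rewrite /two_row /=; lia.
have := dP i (ltnW iN); have := dF i (ltnW iN); have := dP _ iN; have := dF _ iN.
have := H _ iN; have := H _ (ltnW iN); rewrite /add_box /= !eastS //.
by do 2!case: (steps _ i) => /=; lia.
Qed.

Lemma pair_of_boundary (F : dyck n) b : boundary n.*2 (steps (sval F)) b ->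
  exists P : dyck_pairs F, (sval P).2 = F /\ forall i, i <= n.*2 ->
    height (sval (sval P).1) i = ((2 * (b i).2)%:Z - height (sval F) i)%R.
Proof.
move=> hb; have /dyckP[eF dF] := svalP F.
(* The value 2l - h rises exactly when l grows on an east step of [F] or stays constant on a south
   step. *)
pose p : lpath n := [tuple (if steps (sval F) i then (b i.+1).2 == (b i).2.+1
                            else (b i.+1).2 == (b i).2) | i < n.*2].
have stepsE i : i < n.*2 -> steps p i =
    (if steps (sval F) i then (b i.+1).2 == (b i).2.+1 else (b i.+1).2 == (b i).2).
  by move=> iN; rewrite /steps -[i]/(nat_of_ord (Ordinal iN)) -tnth_nth tnth_mktuple.
have eF' i : i <= n.*2 -> east (sval F) i <= i.
  by move=> iN; have := east_south (sval F) iN; lia.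
have eE i : i <= n.*2 -> east p i = (b i).2 + i - east (sval F) i.
  elim: i => [|i IH] iN; first by rewrite !east0 (boundary0 hb).
  have := boundary_step hb iN; have := eF' _ (ltnW iN).
  rewrite eastS // IH ?(ltnW iN) // stepsE // eastS //.
  case: (steps _ i) => le [_ [->|->]]; rewrite ?eqxx.
  - by rewrite (ltn_eqF (ltnSn _)); lia.
  - lia.
  - lia.
  by rewrite (ltn_eqF (ltnSn _)); lia.
have sizeE i iN := @boundary_fst F b i hb iN.
have dp : is_dyck p.
  apply/dyckP; split=> [|i iN].
    by rewrite eE // (boundaryN hb) eF -addnn /=; lia.
  have := boundary_two_row hb iN; rewrite /two_row sizeE // eE //.
  have := eF' _ iN; lia.
have na : never_above p (sval F).
  apply/never_aboveP => // [|i iN]; first exact: svalP F.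
  have := boundary_two_row hb iN; rewrite /two_row sizeE // eE //.
  have := eF' _ iN; have := dF _ iN; lia.
pose P : dyck n * dyck n := (exist _ p dp, F).
have hP : (P.2 == F) && never_above (sval P.1) (sval P.2) by rewrite eqxx.
exists (exist (fun P : dyck n * dyck n =>
  (P.2 == F) && never_above (sval P.1) (sval P.2)) P hP); split=> // i iN /=.
rewrite !heightE // eE //.
have := boundary_two_row hb iN; rewrite /two_row sizeE //.
have := eF' _ iN; have := dF _ iN; lia.
Qed.

Lemma dyck_pairs_inj (F : dyck n) (P Q : dyck_pairs F) :
  (forall i, i <= n.*2 -> height (sval (sval P).1) i = height (sval (sval Q).1) i) ->
  P = Q.
Proof.
case: P Q => [[P G] hP] [[Q G'] hQ] /= e; apply: val_inj => /=.
case/andP: (hP) => /eqP/= -> _; case/andP: (hQ) => /eqP/= -> _.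
by congr pair; apply: val_inj; apply: dyck_height_inj.
Qed.

(** Shared by placements and matchings. Injectivity holds because nests on the diagonal determine
    the arcs; surjectivity comes from the table of the diagonal of a given pair. *)
Lemma encoding_bijection (F : dyck n) (T : finType) (enc : T -> rel nat) :
  (forall t, perfect n.*2 (steps (sval F)) (enc t)) ->
  (forall t t', enc t =2 enc t' -> t = t') ->
  (forall S, perfect n.*2 (steps (sval F)) S -> exists t, enc t =2 S) ->
  exists delta : T -> dyck_pairs F,
    (forall t, (sval (delta t)).2 = F /\ forall i, i <= n.*2 ->
      height (sval (sval (delta t)).1) i =
        ((2 * nest n.*2 (enc t) i i)%:Z - height (sval F) i)%R) /\
    bijective delta.
Proof.
move=> penc inj surj.
have [delta hdelta] := fin_all_exists (fun t => pair_of_boundary (perfect_boundary (penc t))).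
exists delta; split=> //.
have dinj : injective delta.
  move=> t t' e; apply: inj; apply: (perfect_inj (penc t) (penc t')) => i iN.
  have [_ /(_ i iN)] := hdelta t; rewrite e; have [_ /(_ i iN) ->] := hdelta t'.
  by rewrite /=; lia.
have ex (P : dyck_pairs F) : exists t, delta t == P.
  have hb := boundary_of_pair P.
  have [t et] := surj _ (table_perfect hb).
  exists t; apply/eqP; apply: dyck_pairs_inj => i iN.
  have [_ ->//] := hdelta t; rewrite /= (eq_nest _ _ _ et) (table_nest hb) //= !heightE //.
  have /dyckP[_ dF] := svalP F; have /dyckP[_ dP] := svalP (sval P).1.
  by have := dF i iN; have := dP i iN; lia.
exists (fun P => xchoose (ex P)) => [t|P]; last exact/eqP/(xchooseP (ex P)).
by apply: dinj; apply/eqP/(xchooseP (ex _)).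
Qed.

End Paths.

(** * Standardization *)

Section Standardize.
Variables (n : nat) (X : {set square n}).
Implicit Types (s : square n) (t : seq (square n)).

Definition col_lt : rel (square n) := fun s s' => s.1 < s'.1.
Definition row_lt : rel (square n) := fun s s' => s.2 < s'.2.
Definition by_col : seq (square n) :=
  sort (fun s t : square n => (s.1 <= t.1)%N) (enum X).
Definition rank s := #|[set t in X | (t.2 <= s.2)%N]|.

Lemma standardizeE : standardize X = map rank by_col.
Proof. by []. Qed.

Lemma mask_standardizeE (m : bitseq) :
  mask m (standardize X) = map rank (mask m by_col).
Proof. by rewrite map_mask. Qed.

Lemma rank_lt s s' : s \in X -> s' \in X -> (rank s < rank s') = (s.2 < s'.2).
Proof.
move=> sX sX'; case: (ltnP s.2 s'.2) => h.
  apply: proper_card; apply/properP; split.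
    by apply/subsetP => u; rewrite !inE => /andP[-> /leq_trans->] //; apply: ltnW.
  by exists s'; rewrite !inE sX' ?leqnn //= -ltnNge.
apply/negbTE; rewrite -leqNgt; apply: subset_leq_card.
by apply/subsetP => u; rewrite !inE => /andP[-> /leq_trans->].
Qed.

Hypothesis col_inj : {in X &, forall s s', s.1 = s'.1 -> s = s'}.

(** The sort is only weakly increasing; distinct columns make it strict. *)
Lemma by_col_sorted : sorted col_lt by_col.
Proof.
have tot : total (fun s t : square n => (s.1 <= t.1)%N) by move=> s t; exact: leq_total.
have tr : transitive (fun s t : square n => (s.1 <= t.1)%N) by move=> s t u; exact: leq_trans.
have := sort_sorted tot (enum X); rewrite -/by_col => so.
have u : uniq by_col by rewrite sort_uniq enum_uniq.
have sub : {subset by_col <= X} by move=> s; rewrite mem_sort mem_enum.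
move: so u sub; case: by_col => //= s t; elim: t s => //= s' t IH s.
case/andP=> le p /andP[ns us] sub; rewrite IH ?andbT //; last first.
  by move=> v vt; apply: sub; rewrite inE vt orbT.
rewrite /col_lt ltn_neqAle le andbT; apply: contraNneq ns => e.
suff -> : s = s' by rewrite mem_head.
by apply: col_inj; rewrite ?sub ?inE ?eqxx ?orbT //; apply: val_inj.
Qed.

(** A strictly sorted list is determined by its members, so [t] is the filter of [by_col] by
    membership in [t]. *)
Lemma subseq_by_col t : subseq t by_col = sorted col_lt t && all (mem X) t.
Proof.
have tr : transitive col_lt by move=> a b c; exact: ltn_trans.
apply/idP/andP => [sub|[so /allP al]].
  split; first exact: (subseq_sorted tr sub by_col_sorted).
  by apply/allP => s /(mem_subseq sub); rewrite mem_sort mem_enum => sX.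
suff -> : t = [seq s <- by_col | s \in t] by apply: filter_subseq.
apply: (irr_sorted_eq tr) => //; first by move=> a; rewrite /col_lt ltnn.
  by apply: sorted_filter => //; exact: by_col_sorted.
move=> s; rewrite mem_filter mem_sort mem_enum.
by case: (boolP (s \in t)) => //= /al sX; symmetry.
Qed.

Lemma mask_standardize (t : seq (square n)) : subseq t by_col ->
  exists m : (size (standardize X)).-tuple bool, mask m (standardize X) = map rank t.
Proof.
case/subseqP => m sm ->; have szm : size m == size (standardize X).
  by rewrite standardizeE size_map sm.
by exists (Tuple szm); rewrite /= standardizeE map_mask.
Qed.

Lemma contains321P : reflect
  (exists s1 s2 s3, [/\ s1 \in X, s2 \in X, s3 \in X,
     s1.1 < s2.1 < s3.1 & s3.2 < s2.2 < s1.2])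
  (contains (standardize X) perm321).
Proof.
apply: (iffP existsP) => [[m]|[s1 [s2 [s3 [X1 X2 X3 /andP[c1 c2] /andP[r1 r2]]]]]].
  rewrite mask_standardizeE; have := mask_subseq m by_col.
  case: (mask m by_col) => [|s1 [|s2 [|s3 [|s4 t]]]]; rewrite ?subseq_by_col /order_isomorphic //=.
  case/andP=> /and3P[c1 c2 _] /and4P[X1 X2 X3 _] /forallP H.
  have /forallP/(_ 1%R)/eqP := H 2%R; have /forallP/(_ 0%R)/eqP := H 1%R.
  rewrite !permE /= !rank_lt // => r2 r1; exists s1, s2, s3.
  by rewrite -/(col_lt s1 s2) -/(col_lt s2 s3) c1 c2 r1 r2.
have [|m e] := @mask_standardize [:: s1; s2; s3].
  by rewrite subseq_by_col /= /col_lt c1 c2 X1 X2 X3.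
exists m; rewrite e /order_isomorphic /=.
have r3 := ltn_trans r1 r2.
apply/forallP => -[[|[|[|//]]] i3]; apply/forallP => -[[|[|[|//]]] j3];
  by rewrite !permE /= ?rank_lt // ?ltnn ?r1 ?r2 ?r3 // ltnNge ltnW.
Qed.

(** [pairwise] is used because it lets the last square, which becomes the innermost arc, be split
    off. *)
Lemma leq_lisP k : reflect
  (exists t, [/\ k <= size t, pairwise col_lt t, pairwise row_lt t & all (mem X) t])
  (k <= lis (standardize X)).
Proof.
have trc : transitive col_lt by move=> a b c; exact: ltn_trans.
have sortedE t : all (mem X) t -> sorted ltn (map rank t) = pairwise row_lt t.
  move=> al; rewrite (sorted_pairwise ltn_trans) pairwise_map.
  by apply: (eq_in_pairwise (P := mem X)) => // s s' sX sX'; apply: rank_lt.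
apply: (iffP idP) => [le|[t [kt ct rt al]]]; last first.
  have sub : subseq t by_col by rewrite subseq_by_col (sorted_pairwise trc) ct.
  have [m e] := mask_standardize sub; apply: leq_trans kt _.
  rewrite -(size_map rank) -e.
  by apply: (@leq_bigmax_cond _ _ (fun m : (size (standardize X)).-tuple bool =>
    size (mask m (standardize X)))); rewrite e sortedE.
case: k le => [|k] le; first by exists [::].
have /existsP[m /andP[so kt]] : [exists m : (size (standardize X)).-tuple bool,
    sorted ltn (mask m (standardize X)) && (k < size (mask m (standardize X)))].
  apply: contraLR le => /existsPn H; rewrite -leqNgt; apply/bigmax_leqP => m so.
  by have := H m; rewrite so -leqNgt.
have := mask_subseq m by_col; rewrite subseq_by_col (sorted_pairwise trc) => /andP[ct al].
exists (mask m by_col); move: so kt; rewrite mask_standardizeE size_map => so kt.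
by split=> //; rewrite -sortedE.
Qed.

End Standardize.

(** * Rook placements as arcs *)

Section Placements.
Variables (n : nat) (DF : dyck n).
Local Notation F := (sval DF).
Local Notation N := (n.*2).
Implicit Types (s : square n) (R : {set square n}).

Definition col_step (c : 'I_n) :=
  find (fun i => steps F i && (east F i == c)) (iota 0 N).
(** The south step spanning row [r] descends from height r + 1 to r, hence follows n - r - 1 south
    steps; the additive form avoids truncation. *)
Definition row_step (r : 'I_n) :=
  find (fun i => ~~ steps F i && (south F i + r.+1 == n)) (iota 0 N).

Lemma southS i : i < N -> south F i.+1 = south F i + ~~ steps F i.
Proof.
move=> iN; have := east_south F iN; have := east_south F (ltnW iN).
by rewrite eastS //; case: steps => /=; lia.
Qed.

Lemma eastN : east F N = n.
Proof. by case/dyckP: (svalP DF). Qed.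

Lemma southN : south F N = n.
Proof. by have := east_south F (leqnn N); rewrite eastN -addnn; lia. Qed.

(** Locates the step that raises a counter from [c] to c + 1; applied to east and to south steps. *)
Lemma discrete_ivt (f : nat -> nat) (w : nat -> bool) c i :
  f 0 = 0 -> (forall k, k < i -> f k.+1 = f k + w k) -> c < f i ->
  exists k, [/\ k < i, w k & f k = c].
Proof.
move=> f0; elim: i => [|i IH] fS; first by rewrite f0.
rewrite fS // => ci; have [ci'|ci'] := ltnP c (f i).
  have [k [ki wk e]] := IH (fun k ki => fS k (ltnW ki)) ci'.
  by exists k; split=> //; apply: ltnW.
by exists i; split=> //; case: (w i) ci => /=; lia.
Qed.

Lemma find_iotaP (a : pred nat) i k :
  k < i -> a k -> find a (iota 0 i) < i /\ a (find a (iota 0 i)).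
Proof.
move=> ki ak; have h : has a (iota 0 i) by apply/hasP; exists k; rewrite ?mem_iota.
have lt := h; rewrite has_find size_iota in lt; split=> //.
by have := nth_find 0 h; rewrite nth_iota.
Qed.

Lemma col_stepP c : [/\ col_step c < N, steps F (col_step c) & east F (col_step c) = c].
Proof.
have [||k [kN wk ek]] := @discrete_ivt (east F) (steps F) c N (east0 F).
- by move=> k kN; rewrite eastS.
- by rewrite eastN.
have [//||lt /andP[-> /eqP->]] := @find_iotaP (fun i => steps F i && (east F i == c)) N k => //.
by rewrite wk ek eqxx.
Qed.

Lemma row_stepP r : [/\ row_step r < N, ~~ steps F (row_step r) &
  south F (row_step r) + r.+1 = n].
Proof.
have [|||k [kN wk ek]] := @discrete_ivt (south F) (fun i => ~~ steps F i) (n - r.+1) N.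
- by rewrite /south take0.
- by move=> k kN; rewrite southS.
- by rewrite southN; have := ltn_ord r; lia.
have [//||lt /andP[-> /eqP->]] :=
  @find_iotaP (fun i => ~~ steps F i && (south F i + r.+1 == n)) N k => //.
by rewrite wk ek subnK ?eqxx ?ltn_ord.
Qed.

Lemma ltn_col_step c i : i <= N -> (col_step c < i) = (c < east F i).
Proof.
have [cN wc ec] := col_stepP c; move=> iN; case: (ltnP (col_step c) i) => h.
  by have := east_mono F h; rewrite eastS // wc ec addn1 => ->.
by have := east_mono F h; rewrite ec ltnNge => ->.
Qed.

Lemma leq_row_step r i : i <= N -> (i <= row_step r) = (r < n - south F i).
Proof.
have [rN wr er] := row_stepP r; move=> iN; case: (ltnP (row_step r) i) => h.
  by have := south_mono F h; rewrite southS // wr; lia.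
by have := south_mono F h; lia.
Qed.

Lemma col_step_mono c c' : (col_step c < col_step c') = (c < c').
Proof. by have [h _ e] := col_stepP c'; rewrite (ltn_col_step _ (ltnW h)) e. Qed.

(** The border descends, so the order of rows is reversed: increasing pairs of rooks become nested
    arcs and decreasing pairs do not. *)
Lemma row_step_mono r r' : (row_step r < row_step r') = (r' < r).
Proof.
have [h _ e] := row_stepP r'; rewrite !ltnNge (leq_row_step _ (ltnW h)).
by congr (~~ _); lia.
Qed.

Lemma col_step_inj : injective col_step.
Proof.
by move=> c c' e; have [_ _ ec] := col_stepP c; have [_ _ ec'] := col_stepP c';
  apply: val_inj; rewrite /= -ec -ec' e.
Qed.

Lemma row_step_inj : injective row_step.
Proof.
move=> r r' e; have [_ _ er] := row_stepP r; have [_ _ er'] := row_stepP r'.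
by apply: val_inj => /=; move: er er'; rewrite e; lia.
Qed.

Lemma col_step_onto a : a < N -> steps F a -> exists c, col_step c = a.
Proof.
move=> aN wa; have lt : east F a < n.
  by have := east_mono F aN; rewrite eastN eastS // wa addn1.
exists (Ordinal lt); have [cN wc /= ec] := col_stepP (Ordinal lt).
case: (ltngtP (col_step (Ordinal lt)) a) => // h.
  by have := east_mono F h; rewrite eastS // wc ec; lia.
by have := east_mono F h; rewrite eastS // wa ec; lia.
Qed.

Lemma row_step_onto a : a < N -> ~~ steps F a -> exists r, row_step r = a.
Proof.
move=> aN wa; have le : south F a < n.
  by have := south_mono F aN; rewrite southN southS // wa addn1.
have lt : n - (south F a).+1 < n by lia.
exists (Ordinal lt); have [rN wr /= er] := row_stepP (Ordinal lt).
case: (ltngtP (row_step (Ordinal lt)) a) => // h.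
  by have := south_mono F h; rewrite southS // wr; lia.
by have := south_mono F h; rewrite southS // wa; lia.
Qed.

(** The squares of Gamma at vertex [i] are those whose arc passes over the point [i]. *)
Lemma mem_Gamma s i : i <= N ->
  (s \in Gamma n (vertex F i)) = (col_step s.1 < i <= row_step s.2).
Proof. by move=> iN; rewrite inE ltn_col_step // leq_row_step. Qed.

Lemma mem_board s : (s \in board F) = (col_step s.1 < row_step s.2).
Proof.
apply/bigcupP/idP => [[i _]|lt].
  by rewrite (mem_Gamma _ (ltnSE (ltn_ord i))) => /andP[]; apply: leq_trans.
have [rN _ _] := row_stepP s.2.
(* The start of the south step spanning the row is the last vertex whose rectangle still contains
   that row. *)
by exists (inord (row_step s.2)) => //; rewrite inordK ?(leqW rN) // (mem_Gamma _ (ltnW rN)) lt /=.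
Qed.

Definition arcs R : rel nat := fun a b =>
  [exists s in R, (col_step s.1 == a) && (row_step s.2 == b)].

Lemma arcsE R s : arcs R (col_step s.1) (row_step s.2) = (s \in R).
Proof.
apply/exists_inP/idP => [[t tR /andP[/eqP e1 /eqP e2]]|sR]; last by exists s; rewrite // !eqxx.
by rewrite -(_ : t = s) //; case: t s e1 e2 {tR} => c r [c' r'] /= /col_step_inj-> /row_step_inj->.
Qed.

Lemma arcs_inj R R' : arcs R =2 arcs R' -> R = R'.
Proof. by move=> e; apply/setP => s; rewrite -!arcsE e. Qed.

(** The last square of an increasing list is the innermost arc, so peeling the list from its end
    follows the recursion of [nest]. *)
Lemma nest_arcs_ge R i j t : 
  pairwise (@col_lt n) t -> pairwise (@row_lt n) t ->
  all (fun s => (s \in R) && (col_step s.1 < i) && (j <= row_step s.2)) t ->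
  size t <= nest N (arcs R) i j.
Proof.
elim/last_ind: t i j => // t s IH i j.
rewrite !pairwise_rcons all_rcons size_rcons.
case/andP=> /allP cs ct /andP[/allP rs rt] /andP[/andP[/andP[sR si] js] /allP al].
have [rN _ _] := row_stepP s.2.
have lt : nest N (arcs R) (col_step s.1) (row_step s.2).+1 < nest N (arcs R) i j.
  by apply: nest_arc; rewrite ?arcsE ?js.
apply: leq_ltn_trans lt; apply: IH => //; apply/allP => u ut; have /andP[/andP[-> _] _] := al u ut.
rewrite col_step_mono row_step_mono.
by apply/andP; split; [apply: (cs u ut) | apply: (rs u ut)].
Qed.

Lemma nest_arcs_le R i j k : k <= nest N (arcs R) i j ->
  exists t, [/\ size t = k, pairwise (@col_lt n) t, pairwise (@row_lt n) t &
    all (fun s => (s \in R) && (col_step s.1 < i) && (j <= row_step s.2)) t].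
Proof.
elim: k i j => [|k IH] i j; first by exists [::].
case E: (nest N (arcs R) i j) => [//|a] ka.
have [p [q [/exists_inP[s sR /andP[/eqP ep /eqP eq]] pi /andP[jq qN] ea]]] := nest_last E.
have [t [st ct rt /allP al]] : exists t, [/\ size t = k, pairwise (@col_lt n) t,
    pairwise (@row_lt n) t &
    all (fun s => (s \in R) && (col_step s.1 < p) && (q.+1 <= row_step s.2)) t].
  by apply: IH; rewrite ea.
exists (rcons t s); rewrite size_rcons !pairwise_rcons ct rt !andbT all_rcons st sR ep eq pi jq.
split=> //; apply/allP => u /al /andP[/andP[uR up] uq].
- by rewrite /col_lt -col_step_mono ep.
- by rewrite /row_lt -row_step_mono eq.
by rewrite uR /=; apply/andP; split; lia.
Qed.

Section Rooks.
Variable R : {set square n}.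
Hypothesis full : full_rook_placement (board F) R.

Lemma rook_in_col c : exists2 s, s \in R & s.1 = c.
Proof.
case/and3P: full => _ /forallP/(_ c)/cards1P[s e] _; exists s.
  by have := set11 s; rewrite -e inE => /andP[].
by have := set11 s; rewrite -e inE => /andP[_ /eqP].
Qed.

Lemma rook_in_row r : exists2 s, s \in R & s.2 = r.
Proof.
case/and3P: full => _ _ /forallP/(_ r)/cards1P[s e]; exists s.
  by have := set11 s; rewrite -e inE => /andP[].
by have := set11 s; rewrite -e inE => /andP[_ /eqP].
Qed.

Lemma rook_col_inj : {in R &, forall s s', s.1 = s'.1 -> s = s'}.
Proof.
case/and3P: full => _ /forallP H _ s s' sR sR' e; have /cards1P[t et] := H s.1.
have : s \in [set t] by rewrite -et inE sR /=.
have : s' \in [set t] by rewrite -et inE sR' e /=.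
by rewrite !inE => /eqP-> /eqP->.
Qed.

Lemma rook_row_inj : {in R &, forall s s', s.2 = s'.2 -> s = s'}.
Proof.
case/and3P: full => _ _ /forallP H s s' sR sR' e; have /cards1P[t et] := H s.2.
have : s \in [set t] by rewrite -et inE sR /=.
have : s' \in [set t] by rewrite -et inE sR' e /=.
by rewrite !inE => /eqP-> /eqP->.
Qed.

Lemma rook_sub_col_inj (X : {set square n}) :
  {in R :&: X &, forall s s', s.1 = s'.1 -> s = s'}.
Proof. by move=> s s' /setIP[sR _] /setIP[sR' _]; apply: rook_col_inj. Qed.

Lemma ell_nest i : i <= N -> ell DF R i = nest N (arcs R) i i.
Proof.
move=> iN; apply/eqP; rewrite eqn_leq; apply/andP; split.
  have /(leq_lisP (@rook_sub_col_inj _))[t [kt ct rt al]] := leqnn (ell DF R i).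
  apply: leq_trans kt _; apply: nest_arcs_ge => //; apply/allP => s /(allP al).
  by rewrite /= in_setI mem_Gamma // andbA.
apply/(leq_lisP (@rook_sub_col_inj _)).
have [t [<- ct rt al]] := nest_arcs_le (leqnn (nest N (arcs R) i i)).
exists t; split=> //; apply/allP => s /(allP al).
by rewrite /= in_setI mem_Gamma // andbA.
Qed.

Lemma avoids_crossing_free :
  placement_avoids DF R perm321 <-> forall i, crossing_free (arcs R) i i.
Proof.
split=> [/forallP H i|H].
  move=> p1 p2 p3 q1 q2 q3 l1 l2 l3 l4 l5 l6.
  case/exists_inP=> s1 s1R /andP[/eqP e1 /eqP f1].
  case/exists_inP=> s2 s2R /andP[/eqP e2 /eqP f2].
  case/exists_inP=> s3 s3R /andP[/eqP e3 /eqP f3].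
  (* The point [i] is arbitrary, but it is at most the closer [q1], hence a border index. *)
  have [rN _ _] := row_stepP s1.2.
  have iN : i < N.+1 by lia.
  have /(contains321P (@rook_sub_col_inj _)) := H (Ordinal iN); apply.
  exists s1, s2, s3; rewrite !in_setI s1R s2R s3R !mem_Gamma // e1 e2 e3 f1 f2 f3.
  rewrite -(col_step_mono s1.1) -(col_step_mono s2.1) -(row_step_mono s2.2) -(row_step_mono s1.2)
    e1 e2 e3 f1 f2 f3.
  by split=> /=; lia.
apply/forallP => i; apply/(contains321P (@rook_sub_col_inj _)).
have iN : i <= N by rewrite -ltnS.
case=> s1 [s2 [s3 []]]; rewrite !in_setI !mem_Gamma //.
rewrite -(col_step_mono s1.1) -(col_step_mono s2.1) -(row_step_mono s2.2) -(row_step_mono s1.2).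
move=> /andP[s1R ?] /andP[s2R ?] /andP[s3R ?] /andP[? ?] /andP[? ?].
apply: (H i (col_step s1.1) (col_step s2.1) (col_step s3.1)
   (row_step s1.2) (row_step s2.2) (row_step s3.2)); rewrite ?arcsE //; lia.
Qed.

Lemma placement_perfect : placement_avoids DF R perm321 ->
  perfect N (steps F) (arcs R).
Proof.
move/avoids_crossing_free => cf; split=> //.
- split=> [p q|p q q'|p p' q].
  + case/exists_inP=> s sR /andP[/eqP<- /eqP<-]; rewrite -mem_board.
    by case/and3P: full => /subsetP -> //; case: (row_stepP s.2).
  + case/exists_inP=> s sR /andP[/eqP<- /eqP<-].
    by case/exists_inP=> t tR /andP[/eqP/col_step_inj/rook_col_inj-> // /eqP].
  case/exists_inP=> s sR /andP[/eqP<- /eqP<-].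
  by case/exists_inP=> t tR /andP[/eqP + /eqP/row_step_inj/rook_row_inj e]; rewrite e.
- move=> p q /exists_inP[s sR /andP[/eqP<- /eqP<-]].
  by case: (col_stepP s.1) => _ -> _; case: (row_stepP s.2) => _ -> _.
- move=> p pN wp; have [c <-] := col_step_onto pN wp; have [s sR <-] := rook_in_col c.
  by exists (row_step s.2); rewrite arcsE.
move=> q qN wq; have [r <-] := row_step_onto qN wq; have [s sR <-] := rook_in_row r.
by exists (col_step s.1); rewrite arcsE.
Qed.

End Rooks.

(** Every opener spans a column and every closer a row, so no arc is lost when [S] is read on
    squares. *)
Lemma arcs_surj S : perfect N (steps F) S -> exists R,
  [/\ full_rook_placement (board F) R, placement_avoids DF R perm321 & arcs R =2 S].
Proof.
move=> pS; pose R := [set s : square n | S (col_step s.1) (row_step s.2)].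
have e : arcs R =2 S.
  move=> p q; apply/exists_inP/idP => [[s + /andP[/eqP<- /eqP<-]]|Spq]; first by rewrite inE.
  have /andP[pq qN] := pm_lt pS Spq; have /andP[wp wq] := perfect_word pS Spq.
  have [c ec] := col_step_onto (ltn_trans pq qN) wp; have [r er] := row_step_onto qN wq.
  by exists (c, r); rewrite ?inE /= ec er ?eqxx.
have full : full_rook_placement (board F) R.
  apply/and3P; split.
  - by apply/subsetP => s; rewrite inE mem_board => /(pm_lt pS)/andP[].
  - apply/forallP => c; have [cN wc _] := col_stepP c.
    have [q Sq] := perfect_opener pS cN wc.
    have /andP[_ wq] := perfect_word pS Sq; have /andP[_ qN] := pm_lt pS Sq.
    have [r er] := row_step_onto qN wq.
    apply/cards1P; exists (c, r); apply/setP => -[c' r']; rewrite !inE /= xpair_eqE.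
    rewrite andbC; case: eqP => //= ->; apply/idP/eqP => [|->]; last by rewrite er.
    by move=> /(pm_row pS Sq); rewrite -er => /row_step_inj.
  apply/forallP => r; have [rN wr _] := row_stepP r.
  have [p Sp] := perfect_closer pS rN wr.
  have /andP[wp _] := perfect_word pS Sp; have /andP[pr _] := pm_lt pS Sp.
  have [c ec] := col_step_onto (ltn_trans pr rN) wp.
  apply/cards1P; exists (c, r); apply/setP => -[c' r']; rewrite !inE /= xpair_eqE.
  case: (r' =P r) => [->|_]; rewrite ?andbT ?andbF //; apply/idP/eqP => [|->]; last by rewrite ec.
  by move=> /(pm_col pS Sp); rewrite -ec => /col_step_inj.
exists R; split=> //; apply/(avoids_crossing_free full) => i p1 p2 p3 q1 q2 q3.
by rewrite !e; apply: (perfect_crossing pS).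
Qed.

End Placements.

(** * Matchings as arcs *)

Section Matchings.
Variable n : nat.
Local Notation N := (n.*2).
Implicit Types (M : {set {set 'I_N}}) (F : lpath n) (S : rel nat).

Definition matching_arcs M : rel nat := fun p q =>
  [exists x : 'I_N, exists y : 'I_N,
     [&& x == p :> nat, y == q :> nat, x < y & [set x; y] \in M]].

Lemma matching_arcsE M (x y : 'I_N) :
  matching_arcs M x y = (x < y) && ([set x; y] \in M).
Proof.
apply/existsP/idP => [[u /existsP[v /and3P[/eqP/val_inj-> /eqP/val_inj-> //]]]|xy].
by exists x; apply/existsP; exists y; rewrite !eqxx.
Qed.

Lemma matching_arcsP M p q : matching_arcs M p q ->
  exists x y : 'I_N, [/\ x = p :> nat, y = q :> nat, x < y & [set x; y] \in M].
Proof.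
by case/existsP=> x /existsP[y /and4P[/eqP ? /eqP ? ? ?]]; exists x, y.
Qed.

Lemma block_pair M B : perfect_matching M -> B \in M ->
  exists x y : 'I_N, x < y /\ B = [set x; y].
Proof.
case/andP=> _ /forall_inP/[apply] /cards2P[x [y [ne ->]]].
have [lt|gt|e] := ltngtP x y; first by exists x, y.
  by exists y, x; rewrite setUC.
by rewrite (val_inj e) eqxx in ne.
Qed.

Lemma block_unique M (x y z : 'I_N) : perfect_matching M ->
  x != y -> [set x; y] \in M -> [set x; z] \in M -> y = z.
Proof.
case/andP=> /and3P[_ tI _] _ ne yM zM.
have e : [set x; y] = [set x; z].
  by rewrite -(def_pblock tI yM (set21 x y)) -(def_pblock tI zM (set21 x z)).
have : y \in [set x; z] by rewrite -e set22.
by rewrite !inE eq_sym (negPf ne) => /eqP.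
Qed.

Lemma block_exists M (x : 'I_N) : perfect_matching M ->
  exists2 y, x != y & [set x; y] \in M.
Proof.
move=> pM; have /andP[/and3P[/eqP cM _ _] _] := pM.
have : x \in cover M by rewrite cM inE.
case/bigcupP=> B BM; have [u [v [uv eB]]] := block_pair pM BM.
rewrite eB in BM *; rewrite !inE => /orP[]/eqP->.
  by exists v => //; apply: contraTneq uv => ->; rewrite ltnn.
by exists u; [apply: contraTneq uv => ->; rewrite ltnn | rewrite setUC].
Qed.

Lemma matching_containsP M : reflect
  (exists p1 p2 p3 q1 q2 q3, [/\ p1 < p2 < p3, p3 < q1, q1 < q2 < q3,
     matching_arcs M p1 q1 & matching_arcs M p2 q2 /\ matching_arcs M p3 q3])
  (matching_contains M perm321).
Proof.
(* Since 321 is the reversal, counting from one the pairs are (i_a, i_(3+a)): exactly a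
   3-crossing. *)
have cod (a : 'I_3) : rev_ord (lshift 3 (perm321 a)) = rshift 3 a.
  by apply: val_inj; rewrite permE /=; have := ltn_ord a; lia.
apply: (iffP existsP) => [[i /andP[/forallP inc /forallP H]]|].
  have lt (a b : 'I_(3 + 3)) : a < b -> i a < i b.
    by move=> ab; have /forallP/(_ b)/implyP := inc a; apply.
  have arc (a : 'I_3) : matching_arcs M (i (lshift 3 a)) (i (rshift 3 a)).
    rewrite matching_arcsE lt /=; last by have := ltn_ord a; lia.
    by have := H a; rewrite cod.
  exists (i (lshift 3 0%R)), (i (lshift 3 1%R)), (i (lshift 3 2%R)).
  exists (i (rshift 3 0%R)), (i (rshift 3 1%R)), (i (rshift 3 2%R)).
  by split; rewrite ?lt ?arc.
move=> [p1 [p2 [p3 [q1 [q2 [q3 [/andP[l1 l2] l3 /andP[l4 l5]]]]]]]].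
case/matching_arcsP=> x1 [y1 [e1 f1 _ M1]] [].
case/matching_arcsP=> x2 [y2 [e2 f2 _ M2]].
case/matching_arcsP=> x3 [y3 [e3 f3 _ M3]].
exists [ffun k : 'I_(3 + 3) => nth x1 [:: x1; x2; x3; y1; y2; y3] k].
apply/andP; split.
  apply/forallP => -[[|[|[|[|[|[|//]]]]]] ia]; apply/forallP => -[[|[|[|[|[|[|//]]]]]] ib];
    by rewrite !ffunE /=; apply/implyP => //; lia.
by apply/forallP => -[[|[|[|//]]] ia]; rewrite cod !ffunE.
Qed.

Lemma matching_perfect F M : perfect_matching M -> matching_shape M = F ->
  ~~ matching_contains M perm321 -> perfect N (steps F) (matching_arcs M).
Proof.
move=> pM eF /matching_containsP nc.
have stepE (x : 'I_N) : steps F x = opener M x.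
  by rewrite -eF /steps -tnth_nth tnth_mktuple.
have ltn_neq (x y : 'I_N) : x < y -> x != y.
  by move=> xy; apply: contraTneq xy => ->; rewrite ltnn.
split.
- split=> [p q|p q q'|p p' q].
  + by case/matching_arcsP=> x [y [<- <- xy _]]; rewrite xy ltn_ord.
  + case/matching_arcsP=> x [y [<- <- xy Mxy]] /matching_arcsP[u [v [/val_inj-> <- uv Mxv]]].
    by rewrite (block_unique pM (ltn_neq _ _ xy) Mxy Mxv).
  case/matching_arcsP=> x [y [<- <- xy +]] /matching_arcsP[u [v [<- /val_inj-> uv +]]].
  rewrite setUC (setUC [set u]) => Mxy Muv.
  by rewrite (block_unique pM _ Mxy Muv) // eq_sym ltn_neq.
- move=> p q /matching_arcsP[x [y [<- <- xy Mxy]]]; rewrite !stepE; apply/andP; split.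
    by apply/existsP; exists y; rewrite xy.
  apply/existsPn => z; apply/andP => -[yz Myz]; rewrite setUC in Mxy.
  have e : x = z by apply: (block_unique pM _ Mxy Myz); rewrite eq_sym ltn_neq.
  by rewrite -e ltnNge ltnW in yz.
- move=> p pN; rewrite -[p]/(nat_of_ord (Ordinal pN)) stepE => /existsP[y /andP[py My]].
  by exists y; rewrite matching_arcsE py.
- move=> q qN; rewrite -[q]/(nat_of_ord (Ordinal qN)) stepE => /existsPn nop.
  have [y ne My] := block_exists (Ordinal qN) pM.
  exists y; rewrite matching_arcsE setUC My andbT.
  have := nop y; rewrite My andbT -leqNgt leq_eqVlt => /orP[/eqP/val_inj e|//].
  by rewrite e eqxx in ne.
move=> i p1 p2 p3 q1 q2 q3 l1 l2 l3 l4 l5 l6 S1 S2 S3; apply: nc.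
exists p1, p2, p3, q1, q2, q3; split; rewrite ?l1 ?l5 //; lia.
Qed.

Lemma matching_arcs_inj M M' : perfect_matching M -> perfect_matching M' ->
  matching_arcs M =2 matching_arcs M' -> M = M'.
Proof.
move=> pM pM' e; apply/eqP; rewrite eqEsubset; apply/andP; split; apply/subsetP => B BM.
  have [x [y [xy eB]]] := block_pair pM BM; have := e x y.
  by rewrite !matching_arcsE xy /= -eB BM => <-.
have [x [y [xy eB]]] := block_pair pM' BM; have := e x y.
by rewrite !matching_arcsE xy /= -eB BM => ->.
Qed.

Lemma set2_lt_inj (x y u v : 'I_N) : x < y -> u < v ->
  [set x; y] = [set u; v] -> x = u /\ y = v.
Proof.
move=> xy uv e.
have : x \in [set u; v] by rewrite -e set21.
have : y \in [set u; v] by rewrite -e set22.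
rewrite !inE => /orP[]/eqP ? /orP[]/eqP ?; subst => //; lia.
Qed.

Lemma matching_arcs_surj F S : perfect N (steps F) S -> exists M,
  [/\ perfect_matching M, matching_shape M = F, ~~ matching_contains M perm321
    & matching_arcs M =2 S].
Proof.
move=> pS; pose M := [set [set z.1; z.2] | z : 'I_N * 'I_N & S z.1 z.2].
have memM (x y : 'I_N) : x < y -> ([set x; y] \in M) = S x y.
  move=> xy; apply/imsetP/idP => [[[u v]]|Sxy]; last by exists (x, y); rewrite ?inE.
  rewrite inE /= => Suv e; have /andP[uv _] := pm_lt pS Suv.
  by have [-> ->] := set2_lt_inj xy uv e.
have arcsS : matching_arcs M =2 S.
  move=> p q; apply/idP/idP => [/matching_arcsP[x [y [<- <- xy]]]|Spq].
    by rewrite memM.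
  have /andP[pq qN] := pm_lt pS Spq; have pN := ltn_trans pq qN.
  rewrite -[p]/(nat_of_ord (Ordinal pN)) -[q]/(nat_of_ord (Ordinal qN)).
  by rewrite matching_arcsE memM // pq.
(* Arcs with a common point coincide: a step is not both an opener and a closer, and each has one
   partner. This gives disjoint blocks. *)
have shareS (p q p' q' : 'I_N) x : S p q -> S p' q' ->
    x \in [set p; q] -> x \in [set p'; q'] -> p = p' /\ q = q'.
  move=> Sq Sq'; have /andP[wp wq] := perfect_word pS Sq.
  have /andP[wp' wq'] := perfect_word pS Sq'.
  rewrite !inE => /orP[]/eqP-> /orP[]/eqP e.
  - by rewrite -e in Sq'; split=> //; apply: val_inj (pm_row pS Sq Sq').
  - by rewrite e (negPf wq') in wp.
  - by rewrite e wp' in wq.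
  by rewrite -e in Sq'; split=> //; apply: val_inj (pm_col pS Sq Sq').
exists M; split=> //.
- apply/andP; split; last first.
    apply/forall_inP => B /imsetP[[x y]]; rewrite inE /= => /(pm_lt pS)/andP[xy _] ->.
    by rewrite cards2; case: (x =P y) xy => // ->; rewrite ltnn.
  apply/and3P; split.
  + rewrite eqEsubset subsetT /=; apply/subsetP => x _; apply/bigcupP.
    case: (boolP (steps F x)) => wx.
      have [q Sq] := perfect_opener pS (ltn_ord x) wx; have /andP[xq qN] := pm_lt pS Sq.
      by exists [set x; Ordinal qN]; rewrite ?memM ?set21.
    have [p Sp] := perfect_closer pS (ltn_ord x) wx; have /andP[px _] := pm_lt pS Sp.
    have pN := ltn_trans px (ltn_ord x).
    by exists [set Ordinal pN; x]; rewrite ?memM ?set22.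
  + apply/trivIsetP => A B /imsetP[[x y]]; rewrite inE /= => Sxy ->.
    case/imsetP=> [[u v]]; rewrite inE /= => Suv -> ne.
    apply/pred0P => z /=; apply/negbTE/negP => /andP[zx zu].
    by have [e1 e2] := shareS _ _ _ _ _ Sxy Suv zx zu; rewrite e1 e2 eqxx in ne.
  by apply/imsetP => -[[x y] _ e]; have := set21 x y; rewrite -e inE.
- apply: eq_from_tnth => x; rewrite tnth_mktuple (tnth_nth false) -/(steps F x).
  apply/existsP/idP => [[y /andP[xy]]|wx].
    by rewrite memM // => /(perfect_word pS)/andP[].
  have [q Sq] := perfect_opener pS (ltn_ord x) wx; have /andP[xq qN] := pm_lt pS Sq.
  by exists (Ordinal qN); rewrite xq memM.
apply/matching_containsP => -[p1 [p2 [p3 [q1 [q2 [q3 []]]]]]].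
move=> /andP[l1 l2] l3 /andP[l4 l5]; rewrite !arcsS => S1 [S2 S3].
(* All three arcs pass over the point [q1], the first closer. *)
exact: (perfect_crossing pS (i := q1) l1 l2 l3 (leqnn _) l4 l5 S1 S2 S3).
Qed.

End Matchings.

(** * The bijections for placements and for matchings *)

Theorem theorem3p4 (n : nat) (F : {set square n}) (DF : dyck n)
    (hF : F = board (sval DF)) :
  (exists delta321 : avoiding_placements F DF perm321 -> dyck_pairs DF,
     (forall R : avoiding_placements F DF perm321,
        (sval (delta321 R)).2 = DF /\
        forall i : nat, i <= n.*2 ->
          height (sval (sval (delta321 R)).1) i =
            ((2 * ell DF (sval R) i)%:Z - height (sval DF) i)%R) /\
     bijective delta321) /\
  (exists g : avoiding_matchings DF perm321 -> dyck_pairs DF, bijective g).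
Proof.
subst F; split.
  (* This subtype is [avoiding_placements] unfolded, with its finite type structure made
     available. *)
  pose T : finType := {R : {set square n} |
    full_rook_placement (board (sval DF)) R && placement_avoids DF R perm321}.
  have [||S pS|delta [hdelta bij]] :=
    @encoding_bijection n DF T (fun R => arcs DF (sval R)).
  - by case=> R /= /andP[full av]; apply: placement_perfect.
  - by move=> R R' e; apply: val_inj; apply: arcs_inj e.
  - have [R [full av e]] := arcs_surj pS.
    have hR : full_rook_placement (board (sval DF)) R && placement_avoids DF R perm321.
      by rewrite full.
    by exists (exist _ R hR).
  exists delta; split=> // R; have [h1 h2] := hdelta R; split=> // i iN.
  by rewrite h2 // -ell_nest //; case/andP: (svalP R).
pose T : finType := {M : {set {set 'I_(n.*2)}} |
  [&& perfect_matching M, matching_shape M == sval DF & ~~ matching_contains M perm321]}.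
have [||S pS|delta [_ bij]] :=
  @encoding_bijection n DF T (fun M => matching_arcs (sval M)).
- by case=> M /= /and3P[pM /eqP sM nc]; apply: matching_perfect.
- move=> M M' e; apply: val_inj; apply: matching_arcs_inj e.
    by case/and3P: (svalP M).
  by case/and3P: (svalP M').
- have [M [pM sM nc e]] := matching_arcs_surj pS.
  have hM : [&& perfect_matching M, matching_shape M == sval DF & ~~ matching_contains M perm321].
    by rewrite pM sM eqxx.
  by exists (exist _ M hM).
by exists delta.
Qed.
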